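(* Let $R$ be a Prüfer domain with a countable number of maximal ideals, and let $M$ be an $R$-module. If there exists a countable ascending chain $0 = M_0 \subseteq M_1 \subseteq \dots \subseteq M_n \subseteq \dots$ $(n < \omega)$ of projective, pure submodules of $M$ such that $M = \bigcup_{n<\omega} M_n$, then $M$ is projective.
   Context: A domain is a commutative ring with identity and without zero divisors. A Prüfer domain is a domain in which every finitely generated ideal is projective. A submodule $N$ of an $R$-module $M$ is pure in $M$ if every finite system of equations $\sum_{j=1}^m r_{ij} x_j = a_i$ $(i=1,\dots,n)$, with $r_{ij}\in R$ and $a_i \in N$, is solvable in $N$ whenever it is solvable in $M$. *)

(* Defs.v *)
From HB Require Import structures.
From mathcomp Require Import all_boot all_order all_algebra.
From mathcomp Require Import classical_sets cardinality.
Set Implicit Arguments.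
Unset Strict Implicit.
Unset Printing Implicit Defensive.
Import GRing.Theory.
Local Open Scope ring_scope.

(* A submodule of M is a term of the library type [submodClosed M]: a
   boolean-valued predicate on M closed under the module operations.  Ideals of
   R are the submodules of the regular module R^o; the improper ideal is one of
   them. *)
Notation ideal R := (submodClosed (R : pzRingType)^o).

Definition submodule_type (R : pzRingType) (M : lmodType R)
  (N : submodClosed M) : Type := {x : M | x \in N}.

Section SubmoduleType.
Variables (R : pzRingType) (M : lmodType R) (N : submodClosed M).
HB.instance Definition _ := [isSub of submodule_type N for @sval M _].
HB.instance Definition _ := [Choice of submodule_type N by <:].
HB.instance Definition _ :=
  [SubChoice_isSubLmodule of submodule_type N by <:].
End SubmoduleType.

Definition projective (R : pzRingType) (P : lmodType R) : Prop :=
  forall (A B : lmodType R) (g : {linear A -> B}) (f : {linear P -> B}),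
    (forall y : B, exists x : A, g x = y) ->
    exists h : {linear P -> A}, forall x : P, g (h x) = f x.

Definition finitely_generated (R : pzRingType) (M : lmodType R)
    (N : submodClosed M) : Prop :=
  exists (n : nat) (s : 'I_n -> M), forall x : M,
    x \in N <-> exists c : 'I_n -> R, x = \sum_(i < n) c i *: s i.

Definition pure_submodule (R : pzRingType) (M : lmodType R)
    (N : submodClosed M) : Prop :=
  forall (n m : nat) (r : 'M[R]_(n, m)) (a : 'I_n -> M),
    (forall i, a i \in N) ->
    (exists x : 'I_m -> M, forall i, \sum_(j < m) r i j *: x j = a i) ->
    exists x : 'I_m -> M,
      (forall j, x j \in N) /\ forall i, \sum_(j < m) r i j *: x j = a i.

Definition maximal_ideal (R : pzRingType) (I : ideal R) : Prop :=
  (1 : R) \notin I /\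
  forall J : ideal R,
    {subset I <= J} -> J =i I \/ forall x : R, x \in J.

Definition prufer_domain (R : idomainType) : Prop :=
  forall I : ideal R, finitely_generated I -> projective (submodule_type I).

(* Main.v *)
(* The proof transposes Hill's criterion for freeness of abelian groups. Writing
   each [N n] as a summand of a free module, consider the submodules [A] of [M]
   such that [A `&` N n] is spanned by basis vectors of [N n] and [A + N n] is
   pure, for every [n]. A lift along a surjection defined on a maximal such [A]
   is total as soon as every [A] can be enlarged, to contain a given element, by
   countably many generators: then [B / A] is the union of an ascending chain of
   finitely generated pure submodules, each of which is a direct summand of the
   next one because [R] is Prufer.
   The enlargement requires that the pure closure of [N n + F] in [M / A], with
   [F] finite, be countably generated over [N n]. This is checked at each of the
   countably many maximal ideals, where divisibility is a total preorder: adding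
   one element [x] at a time, either the set of [t] such that [x] is divisible
   by [t] modulo the closure obtained so far has a countable cofinal subset, or
   every countable subset of it is bounded. In the latter case [x] is
   approximated modulo all these [t] from one and the same finite set, and the
   set has a maximum. *)
Require Import Defs.
From HB Require Import structures.
From mathcomp Require Import all_boot all_order all_algebra.
From mathcomp Require Import boolp classical_sets functions cardinality.
From mathcomp Require Import ring_quotient generic_quotient freeg.
Set Implicit Arguments.
Unset Strict Implicit.
Unset Printing Implicit Defensive.
Import GRing.Theory.
Local Open Scope ring_scope.
Local Open Scope classical_set_scope.
Local Open Scope quotient_scope.

(** * Maximal sets above a given one *)

(** Zorn's lemma is applied to the sets whose union with [X0] satisfies [Q], so that [Q X0] settles
    the empty chain. *)
Lemma Zorn_union (T : Type) (Q : set (set T)) (X0 : set T) :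
  Q X0 ->
  (forall F : set (set T), F !=set0 -> F `<=` Q -> total_on F subset ->
     Q (\bigcup_(X in F) X)) ->
  exists A, [/\ Q A, X0 `<=` A & forall B, Q B -> A `<=` B -> B `<=` A].
Proof.
move=> QX0 Qcup.
have [|A [QA Amax]] := @Zorn_bigcup T [set X | Q (X0 `|` X)].
  move=> F FQ Ftot /=.
  have [[X FX]|F0] := pselect (F !=set0); last first.
    suff -> : X0 `|` \bigcup_(X in F) X = X0 by [].
    apply/seteqP; split=> [y [//|[X FX _]]|y]; last by left.
    by case: F0; exists X.
  have -> : X0 `|` \bigcup_(X in F) X =
            \bigcup_(Y in [set X0 `|` X | X in F]) Y.
    apply/seteqP; split=> [y [X0y|[Y FY Yy]]|y [_ [Y FY <-] [X0y|Yy]]].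
    - by exists (X0 `|` X); [exists X|left].
    - by exists (X0 `|` Y); [exists Y|right].
    - by left.
    - by right; exists Y.
  apply: Qcup; first by exists (X0 `|` X); exists X.
    by move=> _ [Y FY <-]; apply: FQ.
  move=> _ _ [Y FY <-] [Z FZ <-].
  by case: (Ftot _ _ FY FZ) => YZ; [left|right]; apply: setUS.
exists (X0 `|` A); split=> //.
move=> B QB AB b Bb; right; apply: contrapT => nAb.
apply: (Amax B); last by rewrite /= setUidr // => y ?; apply: AB; left.
by split=> [y Ay|BA]; [apply: AB; right|apply/nAb/BA].
Qed.

(** * Submodules, spans and pure closures *)

Section Span.
Variables (R : idomainType) (U : lmodType R).
Implicit Types (A B S N : set U) (u v p q : U).

Definition submod A := A 0 /\ forall c u v, A u -> A v -> A (c *: u + v).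

Inductive span S : U -> Prop :=
| span_gen v of S v : span S v
| span0 : span S 0
| span_lin c u v of span S u & span S v : span S (c *: u + v).

(** The preimage of the torsion submodule of the quotient by [span S]; by [purif_sub] it is the
    least pure submodule containing [S]. *)
Definition purif S : set U := [set p | exists2 r : R, r != 0 & span S (r *: p)].

(** For a submodule: the quotient is torsion-free. In a torsion-free module this follows from purity
    for systems of equations. *)
Definition pure S := forall (r : R) p, r != 0 -> S (r *: p) -> S p.

Definition torsion_free :=
  forall (r : R) u, r != 0 -> r *: u = 0 -> u = 0.

(** Functionals on a submodule are plain functions on [U] whose values outside [N] are
    irrelevant. *)
Definition linear_on N (f : U -> R) :=
  forall c u v, N u -> N v -> f (c *: u + v) = c * f u + f v.

Lemma submod_span S : submod (span S).
Proof. by split; [exact: span0|exact: span_lin]. Qed.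

Lemma submodZ A c u : submod A -> A u -> A (c *: u).
Proof. by move=> [A0 AL] Au; rewrite -[_ *: _]addr0; apply: AL. Qed.

Lemma submodD A u v : submod A -> A u -> A v -> A (u + v).
Proof. by move=> [A0 AL] Au Av; rewrite -[u]scale1r; apply: AL. Qed.

Lemma submodB A u v : submod A -> A u -> A v -> A (u - v).
Proof. by move=> [A0 AL] Au Av; rewrite addrC -scaleN1r; apply: AL. Qed.

Lemma submod_sum A (I : eqType) (l : seq I) (f : I -> U) :
  submod A -> (forall i, i \in l -> A (f i)) -> A (\sum_(i <- l) f i).
Proof.
move=> sA Af; rewrite big_seq_cond; apply: big_ind => [|u v Au Av|i].
- by case: sA.
- exact: submodD.
- by rewrite andbT; apply: Af.
Qed.

Lemma span_sub S A : submod A -> S `<=` A -> span S `<=` A.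
Proof.
move=> [A0 AL] SA p; elim=> {p} [v /SA//|//|c u v _ Au _ Av]; exact: AL.
Qed.

Lemma span_mono S S' : S `<=` S' -> span S `<=` span S'.
Proof.
move=> SS'; apply: span_sub; first exact: submod_span.
by move=> v /SS'; apply: span_gen.
Qed.

Lemma spanZ S c u : span S u -> span S (c *: u).
Proof. exact: submodZ (submod_span S). Qed.

Lemma spanD S u v : span S u -> span S v -> span S (u + v).
Proof. exact: submodD (submod_span S). Qed.

Lemma spanB S u v : span S u -> span S v -> span S (u - v).
Proof. exact: submodB (submod_span S). Qed.

Lemma span_id A : submod A -> span A `<=` A.
Proof. by move=> sA; apply: span_sub. Qed.

Lemma spanUP S S' p :
  span (S `|` S') p <-> exists u v, [/\ span S u, span S' v & p = u + v].
Proof.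
split=> [|[u [v [Su Sv ->]]]]; last first.
  by apply: spanD; [apply: span_mono Su|apply: span_mono Sv] => y; [left|right].
elim=> {p} [p [Sp|Sp]||c _ _ _ [u [v [Su Sv ->]]] _ [u' [v' [Su' Sv' ->]]]].
- by exists p, 0; split; [exact: span_gen|exact: span0|rewrite addr0].
- by exists 0, p; split; [exact: span0|exact: span_gen|rewrite add0r].
- by exists 0, 0; split; [exact: span0|exact: span0|rewrite addr0].
- exists (c *: u + u'), (c *: v + v').
  by split; [exact: span_lin|exact: span_lin|rewrite scalerDr addrACA].
Qed.

Lemma span1P x p : span [set x] p <-> exists c, p = c *: x.
Proof.
split=> [|[c ->]]; last by apply/spanZ/span_gen.
elim=> {p} [_ ->||c _ _ _ [d ->] _ [e ->]]; first by exists 1; rewrite scale1r.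
  by exists 0; rewrite scale0r.
by exists (c * d + e); rewrite scalerDl scalerA.
Qed.

Lemma span_consP x (F : seq U) p :
  span [set` x :: F] p <-> exists c u, span [set` F] u /\ p = c *: x + u.
Proof.
have -> : [set` x :: F] = [set x] `|` [set` F].
  apply/seteqP; split=> y /=; rewrite in_cons; first by case/predU1P; [left|right].
  by case=> [->|->]; rewrite ?eqxx ?orbT.
split=> [/spanUP[_ [u [/span1P[c ->] Fu ->]]]|[c [u [Fu ->]]]]; first by exists c, u.
by apply/spanUP; exists (c *: x), u; split=> //; apply/span1P; exists c.
Qed.

Lemma span_nil p : span [set` [::]] p -> p = 0.
Proof. by elim=> // c u v _ -> _ ->; rewrite scaler0 addr0. Qed.

Lemma span_seq_sub (F : seq U) A : submod A -> (forall v, v \in F -> A v) ->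
  span [set` F] `<=` A.
Proof. by move=> sA FA; apply: span_sub. Qed.

Lemma submod_purif S : submod (purif S).
Proof.
split; first by exists 1; rewrite ?oner_neq0// scaler0; exact: span0.
move=> c u v [r r0 ru] [s s0 sv]; exists (r * s); first by rewrite mulf_neq0.
rewrite scalerDr -[_ *: v]scalerA; apply: spanD; last exact: spanZ.
have -> : (r * s) *: (c *: u) = (s * c) *: (r *: u).
  by rewrite !scalerA -mulrA mulrC.
exact: spanZ.
Qed.

Lemma span_purif S : span S `<=` purif S.
Proof. by move=> p; exists 1; rewrite ?oner_neq0 ?scale1r. Qed.

Lemma purif_mono S S' : S `<=` S' -> purif S `<=` purif S'.
Proof. by move=> SS' p [r r0 rp]; exists r => //; apply: span_mono rp. Qed.

Lemma pure_purif S : pure (purif S).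
Proof.
move=> r p r0 [s s0 srp]; exists (s * r); first by rewrite mulf_neq0.
by rewrite -scalerA.
Qed.

Lemma purif_sub S A : submod A -> pure A -> S `<=` A -> purif S `<=` A.
Proof. by move=> sA pA SA p [r r0 /(span_sub sA SA)]; apply: pA. Qed.

Lemma torsion_freeI (r : R) u v : torsion_free -> r != 0 ->
  r *: u = r *: v -> u = v.
Proof.
move=> tf r0 /eqP; rewrite -subr_eq0 -scalerBr => /eqP/(tf _ _ r0)/eqP.
by rewrite subr_eq0 => /eqP.
Qed.

Lemma span_seq_finite S p : span S p ->
  exists2 F : seq U, (forall v, v \in F -> S v) & span [set` F] p.
Proof.
elim=> {p} [v Sv||c u v _ [F FS Fu] _ [G GS Gv]].
- exists [:: v] => [w|]; first by rewrite inE => /eqP->.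
  by apply: span_gen; rewrite /= inE.
- by exists [::] => //; exact: span0.
- exists (F ++ G) => [w|]; first by rewrite mem_cat => /orP[/FS|/GS].
  apply: span_lin; [apply: span_mono Fu|apply: span_mono Gv] => w /= wF.
    by rewrite mem_cat wF.
  by rewrite mem_cat wF orbT.
Qed.

Lemma linear_on0 N f : submod N -> linear_on N f -> f 0 = 0.
Proof.
move=> [N0 _] /(_ (-1) 0 0 N0 N0); rewrite scaler0 addr0 => ->.
by rewrite mulN1r addNr.
Qed.

Lemma linear_onZ N f c u : submod N -> linear_on N f -> N u ->
  f (c *: u) = c * f u.
Proof.
move=> sN fl Nu; rewrite -[c *: u]addr0 fl ?(linear_on0 sN fl) ?addr0//.
by case: sN.
Qed.

Lemma linear_onB N f u v : linear_on N f -> N u -> N v ->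
  f (u - v) = f u - f v.
Proof.
by move=> fl Nu Nv; rewrite addrC -scaleN1r fl// mulN1r addrC.
Qed.

End Span.

(** * Quotients, dual bases and Prufer domains *)

Lemma linear_pack (R : pzRingType) (A B : lmodType R) (g : A -> B) :
  linear g -> exists G : {linear A -> B}, forall x, G x = g x.
Proof.
move=> gl.
by exists (HB.pack_for {linear A -> B} g (GRing.isLinear.Build R A B *:%R g gl)).
Qed.

Lemma submodClosed_pack (R : idomainType) (U : lmodType R) (A : set U) :
  submod A -> exists J : submodClosed U, forall x, x \in J <-> A x.
Proof.
move=> [A0 AL]; pose P : {pred U} := fun x => `[< A x >].
have PL : GRing.submod_closed P.
  split=> [|c u v]; first exact/asboolP.
  by rewrite !unfold_in => /asboolP Au /asboolP Av; apply/asboolP/AL.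
exists (HB.pack_for (submodClosed U) P (GRing.isSubmodClosed.Build R U P PL)).
by move=> x; split=> [/asboolP|Ax]; last exact/asboolP.
Qed.

Lemma quotient_exists (R : idomainType) (M : lmodType R) (A : set M) :
  submod A -> exists (U : lmodType R) (q : {linear M -> U}),
    (forall u, exists x, q x = u) /\ (forall x, q x = 0 <-> A x).
Proof.
move=> sA; pose P : {pred M} := fun x => `[< A x >].
have PZ : GRing.zmod_closed P.
  split=> [|u v]; first by apply/asboolP; case: sA.
  by rewrite !unfold_in => /asboolP Au /asboolP Av; apply/asboolP; exact: submodB.
pose J := HB.pack_for (zmodClosed M) P (GRing.isZmodClosed.Build M P PZ).
pose Q := Quotient.quot J.
pose pi (x : M) : Q := \pi x.
have piE (x y : M) : pi x = pi y <-> A (x - y).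
  rewrite -[A _]asboolE -[asbool _]/(x - y \in J) Quotient.idealrBE.
  by split=> /eqP.
have piD x y : pi (x + y) = pi x + pi y by rewrite /pi raddfD.
have reprKpi u : pi (repr u) = u by rewrite /pi reprK.
have piP (u : Q) : exists x, pi x = u by exists (repr u).
pose sc (c : R) (u : Q) : Q := pi (c *: repr u).
have scE c x : sc c (pi x) = pi (c *: x).
  by apply/piE; rewrite -scalerBr; apply: (submodZ c sA); apply/piE.
have scA a b v : sc a (sc b v) = sc (a * b) v.
  by have [x <-] := piP v; rewrite !scE scalerA.
have sc1 : left_id 1 sc by move=> v; have [x <-] := piP v; rewrite scE scale1r.
have scDr : right_distributive sc +%R.
  move=> a u v; have [x <-] := piP u; have [y <-] := piP v.
  by rewrite -piD !scE -piD scalerDr.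
have scDl v : {morph sc^~ v : a b / a + b}.
  by have [x <-] := piP v => a b; rewrite !scE -piD scalerDl.
pose U : lmodType R := HB.pack_for (lmodType R) Q
  (GRing.Zmodule_isLmodule.Build R Q scA sc1 scDr scDl).
have ql : linear (pi : M -> U).
  by move=> a x y; rewrite piD -scE.
have [q qE] := linear_pack ql.
exists U, q; split=> [u|x]; first by have [x <-] := piP u; exists x; rewrite qE.
by rewrite -{2}[x]subr0 -piE -!qE linear0.
Qed.

(** The criterion of the dual basis lemma for projectivity of [N]; the list [l] encodes finite
    support at [p]. *)
Definition dual_basis (R : idomainType) (U : lmodType R) (N : set U)
    (X : choiceType) (b : X -> U) (phi : X -> U -> R) : Prop :=
  [/\ forall j, N (b j), forall j, linear_on N (phi j) &
      forall p, N p -> exists l : seq X,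
        [/\ uniq l, forall j, phi j p != 0 -> j \in l &
            p = \sum_(j <- l) phi j p *: b j]].

(** Projectivity splits the canonical map from the free module on the elements of [N] onto [N]; the
    coordinates of the section are the functionals. *)
Lemma projective_dual_basis (R : idomainType) (M : lmodType R)
    (N : submodClosed M) :
  projective (submodule_type N) ->
  exists phi : submodule_type N -> M -> R, dual_basis [set` N] val phi.
Proof.
set X := submodule_type N => projN.
pose F : lmodType R := {freeg X / R}.
pose g (D : F) : X := \sum_(x <- dom D) coeff x D *: x.
(* The sum may run over any duplicate-free list containing the support; linearity needs one list
   common to two formal sums. *)
have gE (D : F) (s : seq X) : uniq s -> {subset dom D <= s} ->
    g D = \sum_(x <- s) coeff x D *: x.
  move=> us sub; rewrite /g.
  rewrite [RHS](bigID (fun x => x \in dom D))/= [X in _ + X]big1 ?addr0.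
    rewrite -[RHS]big_filter; apply: perm_big; apply: uniq_perm => //.
    - exact: uniq_dom.
    - exact: filter_uniq.
    - by move=> x; rewrite mem_filter; case: (boolP (x \in dom D)) => // /sub->.
  by move=> x /coeff_outdom->; rewrite scale0r.
have gl : linear g.
  move=> c D E; pose s := undup (dom D ++ dom E).
  have us : uniq s := undup_uniq _.
  have sD : {subset dom D <= s} by move=> x; rewrite mem_undup mem_cat => ->.
  have sE : {subset dom E <= s}.
    by move=> x; rewrite mem_undup mem_cat => ->; rewrite orbT.
  rewrite (gE D s)// (gE E s)// (gE (c *: D + E) s)//.
    rewrite scaler_sumr -big_split; apply: eq_bigr => x _ /=.
    by rewrite coeffD coeffZ scalerDl scalerA.
  move=> x /domD_subset; rewrite mem_cat => /orP[/domZ_subset|]; first exact: sD.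
  exact: sE.
have [G GE] := linear_pack gl.
have [y|h hE] := projN F X G idfun.
  exists << y >>; rewrite GE /g domU1 big_seq1.
  by rewrite coeffU eqxx mulr1 scale1r.
pose phi (j : X) (p : M) : R := if insub p is Some u then coeff j (h u) else 0.
have phiE j (u : X) : phi j (val u) = coeff j (h u) by rewrite /phi valK.
exists phi; split=> [j|j c u v|p]; first exact: valP.
  move=> uN vN.
  have -> : u = val (Sub u uN : X) by rewrite SubK.
  have -> : v = val (Sub v vN : X) by rewrite SubK.
  by rewrite -linearZ -raddfD !phiE linearP coeffD coeffZ.
move=> pN; have -> : p = val (Sub p pN : X) by rewrite SubK.
exists (dom (h (Sub p pN))); split; first exact: uniq_dom.
  move=> j; rewrite phiE => h0; apply: contraNT h0 => /coeff_outdom->//.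
rewrite -{1}[Sub p pN]hE GE /g raddf_sum; apply: eq_bigr => j _.
by rewrite phiE.
Qed.

(** Column [l] of [H] is the image of [a l] under a section of the map from R^k onto the ideal
    generated by the [a i]. The second identity is linearity applied to the product of [a m] and
    [a l], read in two ways. *)
Lemma prufer_dual (R : idomainType) : prufer_domain R ->
  forall k (a : 'I_k -> R), exists H : 'I_k -> 'I_k -> R,
    (forall l, \sum_j a j * H j l = a l) /\
    (forall j l m, a m * H j l = a l * H j m).
Proof.
move=> prR k a.
pose D : set R^o := [set x | exists c : 'I_k -> R, x = \sum_i c i *: (a i : R^o)].
have sD : submod D.
  split; first by exists (fun=> 0); rewrite big1// => i _; rewrite scale0r.
  move=> c u v [d ->] [e ->]; exists (fun i => c * d i + e i).
  rewrite scaler_sumr -big_split; apply: eq_bigr => i _ /=.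
  by rewrite scalerDl scalerA.
have [J JD] := submodClosed_pack sD.
have fgJ : finitely_generated J by exists k, a.
have gJ (c : 'rV[R]_k) : (\sum_i c 0 i *: (a i : R^o)) \in J.
  by apply/JD; exists (c 0).
pose sub x (xJ : x \in J) : submodule_type J := exist _ x xJ.
have subE x xJ : \val (@sub x xJ) = x by [].
pose g c := sub _ (gJ c).
have gl : linear g.
  move=> c u v; apply: val_inj; rewrite -[RHS]/(c *: \val (g u) + \val (g v)) !subE.
  rewrite scaler_sumr -big_split; apply: eq_bigr => i _ /=.
  by rewrite !mxE scalerDl scalerA.
have [G GE] := linear_pack gl.
have [y|h hE] := prR J fgJ _ _ G idfun.
  have /JD[c cE] := valP y; exists (\row_i c i).
  rewrite GE; apply: val_inj; rewrite subE [RHS]cE.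
  by apply: eq_bigr => i _; rewrite mxE.
have aJ l : (a l : R^o) \in J.
  apply/JD; exists (fun i => (i == l)%:R); rewrite (bigD1 l)//= eqxx scale1r.
  by rewrite big1 ?addr0// => i /negPf->; rewrite scale0r.
exists (fun j l => h (sub _ (aJ l)) 0 j); split=> [l|j l m].
  have := congr1 val (hE (sub _ (aJ l))); rewrite GE !subE => {2}<-.
  by apply: eq_bigr => i _; rewrite mulrC.
have : a m *: sub _ (aJ l) = a l *: sub _ (aJ m).
  by apply: val_inj; exact: mulrC.
by move=> /(congr1 (fun u => h u 0 j)); rewrite !linearZ !mxE.
Qed.

(** Where [s] is invertible [a] divides [b], and where [t] is invertible [b] divides [a]:
    divisibility is locally total. For nonzero [a] the multipliers are the diagonal entries of
    [H]. *)
Lemma prufer_local (R : idomainType) : prufer_domain R ->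
  forall a b : R, exists s t u v : R,
    [/\ s + t = 1, s * b = a * u & t * a = b * v].
Proof.
move=> prR a b.
have [->|a0] := eqVneq a 0.
  by exists 0, 1, 0, 0; rewrite add0r !mul0r mul1r mulr0.
have [H [H1 H2]] := prufer_dual prR (fun i : 'I_2 => if i == 0 then a else b).
have e1 : a * H 0 0 + b * H 1 0 = a.
  have := H1 0; rewrite big_ord_recl big_ord1 /=.
  by have -> : fintype.lift ord0 ord0 = 1 :> 'I_2 by apply/val_inj.
have e2 : b * H 0 0 = a * H 0 1 := H2 0 0 1.
have e3 : a * H 1 1 = b * H 1 0 := H2 1 1 0.
exists (H 0 0), (H 1 1), (H 0 1), (H 1 0); split.
- by apply: (mulfI a0); rewrite mulr1 mulrDr e3.
- by rewrite mulrC.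
- by rewrite mulrC.
Qed.

(** * Projections onto pure closures of finite sets *)

Section FiniteProjection.
Variables (R : idomainType) (U : lmodType R).
Implicit Types (N S : set U) (e p : U).

(** The dual basis condition for one element at a time, with [f] and [b] depending on [e]. *)
Definition locally_projective N := forall e, N e ->
  exists k (f : 'I_k -> U -> R) (b : 'I_k -> U),
    [/\ forall i, linear_on N (f i), forall i, N (b i) &
        e = \sum_i f i e *: b i].

(** The expansion along [f] and [b] projects [N] onto its intersection with [purif S], which is
    therefore finitely generated. *)
Definition finite_projection N S (I : finType) (f : I -> U -> R) (b : I -> U) :=
  [/\ forall i, linear_on N (f i), forall i, N (b i), forall i, purif S (b i) &
      forall p, N p -> purif S p -> p = \sum_i f i p *: b i].

Lemma dual_basis_locally_projective N (X : choiceType) (b : X -> U) phi :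
  dual_basis N b phi -> locally_projective N.
Proof.
move=> [Nb phil phiP] e Ne; have [l [_ _ el]] := phiP e Ne.
exists (size l), (fun i => phi (tnth (in_tuple l) i)),
  (fun i => b (tnth (in_tuple l) i)); split=> //.
by rewrite {1}el big_tnth.
Qed.

Lemma sum_linear N (W : lmodType R) (I : finType) (f : I -> U -> R) (b : I -> W) c u v :
  (forall i, linear_on N (f i)) -> N u -> N v ->
  \sum_i f i (c *: u + v) *: b i =
  c *: (\sum_i f i u *: b i) + \sum_i f i v *: b i.
Proof.
move=> fl Nu Nv; rewrite scaler_sumr -big_split; apply: eq_bigr => i _ /=.
by rewrite fl// scalerDl scalerA.
Qed.

Lemma sum_scale N (I : finType) (f : I -> U -> R) (b : I -> U) c u :
  submod N -> (forall i, linear_on N (f i)) -> N u ->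
  \sum_i f i (c *: u) *: b i = c *: (\sum_i f i u *: b i).
Proof.
move=> sN fl Nu; rewrite scaler_sumr; apply: eq_bigr => i _ /=.
by rewrite (linear_onZ c sN (fl i))// scalerA.
Qed.

(** For nonzero [e] the ideal of the coordinates [f i e] is invertible. Dividing by it turns the
    [b l] into vectors [d j] of the pure closure of [e] ([dE]) that still recover [e] ([piE]), hence
    all elements with a nonzero multiple proportional to [e]. *)
Lemma rank1_projection N e : prufer_domain R -> torsion_free U -> submod N ->
  locally_projective N -> N e ->
  exists (I : finType) (f : I -> U -> R) (b : I -> U),
    finite_projection N [set e] f b.
Proof.
move=> prR tf sN lpN Ne.
have [e0|/eqP e0] := eqVneq e 0.
  exists 'I_0, (fun _ _ => 0), (fun _ => 0); split=> [[]//|[]//|[]//|p Np].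
  move=> [r r0 /span1P[c]]; rewrite e0 scaler0 => /(tf _ _ r0)->.
  by rewrite big_ord0.
have [k [f [b [fl Nb eE]]]] := lpN e Ne.
have [H [H1 H2]] := prufer_dual prR (fun i => f i e).
pose d j := \sum_l H j l *: b l.
have Nd j : N (d j) by apply: submod_sum => // l _; apply: submodZ.
have dE m j : f m e *: d j = H j m *: e.
  rewrite {2}eE !scaler_sumr; apply: eq_bigr => l _.
  by rewrite !scalerA H2 mulrC.
have piE : \sum_j f j e *: d j = e.
  rewrite {2}eE (eq_bigr (fun j => \sum_l (f j e * H j l) *: b l)); last first.
    by move=> j _; rewrite scaler_sumr; apply: eq_bigr => l _; rewrite scalerA.
  rewrite exchange_big; apply: eq_bigr => l _ /=.
  by rewrite -scaler_suml H1.
have [m am] : exists m, f m e != 0.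
  apply: contrapT => /forallNP f0e; apply: e0; rewrite eE big1// => i _.
  by have /negP := f0e i; rewrite negbK => /eqP->; rewrite scale0r.
exists _, f, d; split=> // [j|p Np [r r0 /span1P[c rp]]].
  by exists (f m e) => //; apply/span1P; exists (H j m).
apply: (torsion_freeI tf r0); rewrite -(sum_scale _ _ sN)// rp.
by rewrite (sum_scale _ _ sN)// piE.
Qed.

(** By induction: once [pi] projects onto the closure of [F], the rank-one projection for
    [e - pi e], applied to [p - pi p], supplies the missing part. *)
Lemma pure_projection N (F : seq U) : prufer_domain R -> torsion_free U ->
  submod N -> locally_projective N -> (forall v, v \in F -> N v) ->
  exists (I : finType) (f : I -> U -> R) (b : I -> U),
    finite_projection N [set` F] f b.
Proof.
move=> prR tf sN lpN; elim: F => [|e F IH] FN.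
  exists 'I_0, (fun _ _ => 0), (fun _ => 0); split=> [[]//|[]//|[]//|p Np].
  by move=> [r r0 /span_nil/(tf _ _ r0)->]; rewrite big_ord0.
have [|I [f [b [fl Nb Fb fE]]]] := IH.
  by move=> v vF; apply: FN; rewrite in_cons vF orbT.
pose pi p := \sum_i f i p *: b i.
have Npi p : N (pi p) by apply: submod_sum => // i _; apply: submodZ.
have Fpi p : purif [set` F] (pi p).
  by apply: submod_sum => [|i _]; [|apply: submodZ (Fb i)]; exact: submod_purif.
have FeF : [set` F] `<=` [set` e :: F].
  by move=> v /= vF; rewrite in_cons vF orbT.
have Ne : N e by apply: FN; rewrite mem_head.
have sub p : N p -> N (p - pi p) by move=> Np; apply: submodB.
have [J [g [d [gl Nd ed gE]]]] := rank1_projection prR tf sN lpN (sub e Ne).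
exists (I + J)%type, (fun k p => match k with inl i => f i p
  | inr j => g j (p - pi p) end), (fun k => match k with inl i => b i
  | inr j => d j end); split.
- case=> [i|j] //= c u v Nu Nv; rewrite -gl//; try exact: sub.
  congr (g j _); rewrite /pi (sum_linear _ _ fl)// scalerBr opprD addrACA//.
- by case.
- case=> [i|j]; first exact: purif_mono (Fb i).
  move: (ed j); apply: purif_sub; [exact: submod_purif|exact: pure_purif|].
  move=> _ ->; apply: submodB; first exact: submod_purif.
    by apply/span_purif/span_gen; rewrite /= mem_head.
  exact: purif_mono (Fpi e).
- move=> p Np [r r0 /span_consP[c [u [Fu rp]]]].
  rewrite big_sumType /= -/(pi p) -gE; [by rewrite addrC subrK|exact: sub|].
  exists r => //; apply/span1P; exists c.
  have -> : r *: (p - pi p) = r *: p - pi (r *: p).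
    by rewrite /pi (sum_scale _ _ sN fl Np) scalerBr.
  have Nu : N u.
    by apply: span_seq_sub Fu => // v vF; apply: FN; rewrite in_cons vF orbT.
  rewrite rp /pi (sum_linear _ _ fl)// -(fE u Nu (span_purif Fu)).
  by rewrite scalerBr opprD addrACA subrr addr0.
Qed.

(** Elimination: if some [n0] in [N] has a nonzero coefficient [c0] at [e], it is kept, and
    subtracting [c *: n0] from [c0 *: p] removes [e]. The factor [c0] is why only the pure closure
    is reached. *)
Lemma span_select N (F : seq U) : submod N ->
  exists E : seq U, (forall v, v \in E -> N v /\ span [set` F] v) /\
    forall p, N p -> span [set` F] p -> purif [set` E] p.
Proof.
move=> sN; elim: F => [|e F [E [EN EP]]].
  exists [::]; split=> // p _ /span_nil->.
  exact/span_purif/span0.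
have FeF : [set` F] `<=` [set` e :: F].
  by move=> v /= vF; rewrite in_cons vF orbT.
have [[c0 [u0 [c00 Fu0 Nn0]]]|no] := pselect (exists c u,
    [/\ c != 0, span [set` F] u & N (c *: e + u)]); last first.
  exists E; split=> [v /EN[Nv Fv]|p Np /span_consP[c [u [Fu pE]]]].
    by split=> //; apply: span_mono Fv.
  have [c0|c0] := eqVneq c 0; last by case: no; exists c, u; split; rewrite -?pE.
  by apply: EP => //; rewrite pE c0 scale0r add0r.
set n0 := c0 *: e + u0 in Nn0.
exists (n0 :: E); split=> [v|p Np /span_consP[c [u [Fu pE]]]].
  rewrite in_cons => /predU1P[->|/EN[Nv Fv]]; split=> //.
    by apply/span_consP; exists c0, u0.
  by apply: span_mono Fv.
have EE : [set` E] `<=` [set` n0 :: E].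
  by move=> v /= vF; rewrite in_cons vF orbT.
apply: (pure_purif c00); rewrite -[c0 *: p](subrK (c *: n0)).
apply: submodD; first exact: submod_purif; last first.
  by apply/span_purif/spanZ/span_gen; rewrite /= mem_head.
apply: (purif_mono EE); apply: EP.
  by apply: submodB => //; apply: submodZ.
rewrite pE /n0 !scalerDr !scalerA opprD mulrC addrACA subrr add0r.
by apply: spanB; apply: spanZ.
Qed.

(** [span_select] captures the intersection up to pure closure, and inside [N] this closure is
    spanned by the vectors of its projection. These need not lie in [span F]. *)
Lemma span_capture N (F : seq U) : prufer_domain R -> torsion_free U ->
  submod N -> locally_projective N ->
  exists E : seq U, (forall v, v \in E -> N v) /\
    forall p, N p -> span [set` F] p -> span [set` E] p.
Proof.
move=> prR tf sN lpN; have [E [EN EP]] := span_select F sN.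
have [|I [f [b [fl Nb _ fE]]]] := pure_projection (F := E) prR tf sN lpN.
  by move=> v /EN[].
exists [seq b i | i <- enum I]; split=> [_ /mapP[i _ ->]//|p Np Fp].
rewrite (fE p Np (EP p Np Fp)); apply: submod_sum => [|i _].
  exact: submod_span.
by apply/spanZ/span_gen => /=; apply: map_f; rewrite mem_enum.
Qed.

End FiniteProjection.

Lemma addr3_eq (V : zmodType) (a b c a' b' c' : V) :
  a + b + c = a' + b' + c' -> a - a' = b' - b + (c' - c).
Proof.
move=> h; apply/eqP; rewrite subr_eq addrA [eqbRHS](ACl (5*1*3*2*4)%AC)/= -h.
by rewrite -[a + b + c]addrA -addrA -opprD addrK.
Qed.

(** * Countable generation of pure closures *)

Section SpanChain.
Variables (R : idomainType) (U : lmodType R).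

Lemma span_chain (Q : nat -> set U) v :
  (forall i j, (i <= j)%N -> Q i `<=` Q j) ->
  span (\bigcup_i Q i) v -> exists i, span (Q i) v.
Proof.
move=> Qm; elim=> {v} [v [i _ Qv]||c u v _ [i Qu] _ [j Qv]].
- by exists i; exact: span_gen.
- by exists 0%N; exact: span0.
- exists (maxn i j); apply: span_lin.
  + by apply: span_mono Qu; apply: Qm; exact: leq_maxl.
  + by apply: span_mono Qv; apply: Qm; exact: leq_maxr.
Qed.

Lemma span_range (z : nat -> U) v :
  span (range z) v -> exists i, span [set` [seq z j | j <- iota 0 i]] v.
Proof.
move=> zv; apply: (span_chain (Q := fun i => [set` [seq z j | j <- iota 0 i]])).
  move=> i j ij _ /mapP[k kP ->]; apply: map_f.
  by move: kP; rewrite !mem_iota !add0n => /leq_trans; apply.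
apply: span_mono zv => _ [k _ <-]; exists k.+1 => //.
by apply/mapP; exists k => //; rewrite mem_iota add0n ltnSn.
Qed.

Lemma dual_basis_support (N : set U) (X : choiceType) (b : X -> U) phi
    (E : seq U) : submod N -> dual_basis N b phi -> (forall v, v \in E -> N v) ->
  exists L : seq X, forall v j, span [set` E] v -> j \notin L -> phi j v = 0.
Proof.
move=> sN [Nb phil phiP]; elim: E => [|e E IH] EN.
  by exists [::] => v j /span_nil-> _; apply: linear_on0 (phil j).
have [|L LP] := IH; first by move=> v vE; apply: EN; rewrite in_cons vE orbT.
have Ne : N e by apply: EN; rewrite mem_head.
have [l [_ lP _]] := phiP e Ne.
exists (l ++ L) => v j /span_consP[c [u [Eu ->]]].
rewrite mem_cat negb_or => /andP[jl jL].
have Nu : N u.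
  by apply: span_seq_sub Eu => // w wE; apply: EN; rewrite in_cons wE orbT.
rewrite (phil j) // (LP u j) // addr0.
have /eqP -> : phi j e == 0; last by rewrite mulr0.
by apply: contraNT jl => /lP.
Qed.

End SpanChain.

(** * Adding one element, locally at a multiplicative set *)

Section LocalStep.
Variables (R : idomainType) (U : lmodType R) (N P : set U) (z : nat -> U) (x : U).
Variables (X : choiceType) (b : X -> U) (phi : X -> U -> R) (Sg : set R).
Hypotheses (prR : prufer_domain R) (tf : torsion_free U).
Hypotheses (sN : submod N) (sP : submod P) (NP : N `<=` P) (pP : pure P).
Hypotheses (dbN : dual_basis N b phi) (lpP : locally_projective P).
Let G := span (N `|` range z).
Hypotheses (zP : forall i, P (z i)) (pG : pure G) (xP : P x) (xG : ~ G x).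
Hypotheses (Sg1 : Sg 1) (SgM : forall s t, Sg s -> Sg t -> Sg (s * t)).
Hypotheses (Sg0 : ~ Sg 0).
Hypothesis Sg_total : forall a c : R, exists2 s, Sg s &
  (exists d, s * c = a * d) \/ (exists d, s * a = c * d).

(* Divisibility in the localization at [Sg]. *)
Let le (t t' : R) := exists2 s, Sg s & exists d, s * t' = t * d.

(** The denominators of [x] modulo [G] after localization at [Sg]; a countable cofinal set of them
    yields countably many generators. *)
Let S (t : R) := exists s p, [/\ Sg s, P p & G (s *: x - t *: p)].

Let sG : submod G. Proof. exact: submod_span. Qed.

Let GP : G `<=` P.
Proof. by apply: span_sub => // v [/NP|[i _ <-]]. Qed.

Let Sgn0 s : Sg s -> s != 0.
Proof. by move=> ss; apply/eqP => s0; apply: Sg0; rewrite -s0. Qed.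

Let S_neq0 t : S t -> t != 0.
Proof.
move=> [s [p [ss _ Gs]]]; apply/eqP => t0; apply: xG; apply: (pG (Sgn0 ss)).
by move: Gs; rewrite t0 scale0r subr0.
Qed.

Let le_total t t' : le t t' \/ le t' t.
Proof. by have [s ss [h|h]] := Sg_total t t'; [left|right]; exists s. Qed.

Let le_trans a c d : le a c -> le c d -> le a d.
Proof.
move=> [s ss [e ee]] [s' ss' [f ff]]; exists (s * s'); first exact: SgM.
by exists (e * f); rewrite -mulrA ff mulrA ee mulrA.
Qed.

(** The generators are [x] and a quotient of [x] by each [tau i] modulo [G]. If
    [r *: p = g + c *: x] with [c] nonzero, then locally either [r] divides [c], and [p] is a
    multiple of [x] modulo [G], or [p] is a quotient of [x] by some [d] in [S], which lies below
    some [tau i]. *)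
Lemma cofinal_generators (tau : nat -> R) :
  (forall i, S (tau i)) -> (forall t, S t -> exists i, le t (tau i)) ->
  exists k : nat -> U,
    (forall i, purif ((N `|` range z) `|` [set x]) (k i)) /\
    forall p r, r != 0 -> span ((N `|` range z) `|` [set x]) (r *: p) ->
      exists2 s, Sg s & span ((N `|` range z) `|` range k) (s *: p).
Proof.
move=> tauS tauC; have /choice[sp spP] : forall i, exists sp : R * U,
    [/\ Sg sp.1, P sp.2 & G (sp.1 *: x - tau i *: sp.2)].
  by move=> i; have [s [p h]] := tauS i; exists (s, p).
pose k i := if i is i'.+1 then (sp i').2 else x.
exists k; split=> [[|i]|p r r0 /spanUP[g [_ [Gg /span1P[c ->] rp]]]].
- by apply/span_purif/span_gen; right.
- have [_ _ Gi] := spP i; exists (tau i); first exact: S_neq0.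
  rewrite -[_ *: k _](subKr ((sp i).1 *: x)).
  apply: spanB; last by apply: span_mono Gi => y; left.
  by apply/spanZ/span_gen; right.
have Pp : P p.
  by apply: (pP r0); rewrite rp; apply: submodD => //; [exact: GP|exact: submodZ].
have Gk : G `<=` span ((N `|` range z) `|` range k).
  by apply: span_mono => y; left.
have kk i : span ((N `|` range z) `|` range k) (k i).
  by apply: span_gen; right; exists i.
have [s ss [[d sc]|[d sr]]] := Sg_total r c.
  exists s => //; have Gd : G (s *: p - d *: x).
    apply: (pG r0); rewrite scalerBr !scalerA -sc mulrC -!scalerA rp scalerDr.
    by rewrite addrK; apply: submodZ.
  rewrite -[s *: p](subrK (d *: x)); apply: spanD; first exact: Gk.
  by apply: spanZ; exact: (kk 0%N).
have [c0|c0] := eqVneq c 0.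
  exists 1 => //; rewrite scale1r; apply: Gk; apply: (pG r0).
  by rewrite rp c0 scale0r addr0.
have Gd : G (d *: p - s *: x).
  apply: (pG c0); rewrite scalerBr scalerA -sr -scalerA rp scalerDr !scalerA.
  by rewrite [c * s]mulrC addrK; apply: submodZ.
have Sd : S d.
  exists s, p; split=> //; rewrite -opprB -scaleN1r; exact: submodZ.
have [i [s' ss' [e se]]] := tauC d Sd; have [si Pi Gi] := spP i.
move: (sp i).1 si Gi => si ssi Gi.
exists (s' * si); first exact: SgM.
rewrite -[X in span _ X](subrK ((s * e) *: (sp i).2)); apply: spanD; last first.
  by apply: spanZ; exact: (kk i.+1).
apply: Gk; apply: (pG (S_neq0 Sd)).
have -> : d *: ((s' * si) *: p - (s * e) *: (sp i).2) =
    (s' * si) *: (d *: p - s *: x) + (s * s') *: (si *: x - tau i *: (sp i).2).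
  rewrite !scalerBr !scalerA [d * _]mulrC [s' * si * s]mulrC [s * (s' * si)]mulrA.
  have -> : d * (s * e) = s * s' * tau i by rewrite mulrCA -se mulrA.
  by rewrite addrA subrK.
by apply: submodD => //; apply: submodZ.
Qed.

Section Bounded.
Hypothesis S_bounded : forall tau : nat -> R, (forall i, S (tau i)) ->
  exists2 t, S t & forall i, le (tau i) t.

(** Counterexamples [tau i] for all [i] would have a bound [t] in [S]; the index that serves [t]
    would serve its own counterexample, by downward closure. *)
Let uniform (Si : nat -> R -> Prop) :
  (forall t, S t -> exists i, Si i t) ->
  (forall i t t', le t t' -> Si i t' -> Si i t) ->
  exists i, forall t, S t -> Si i t.
Proof.
move=> SSi Sid; apply: contrapT => /forallNP no.
have /choice[tau tauP] : forall i, exists t, S t /\ ~ Si i t.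
  by move=> i; have /existsNP[t /not_implyP[]] := no i; exists t.
have [|t St tt] := S_bounded (tau := tau); first by move=> i; have [] := tauP i.
have [i Sit] := SSi t St; have [_] := tauP i; apply.
exact: Sid (tt i) Sit.
Qed.

Let T t s w := [/\ Sg s, N w & exists u p,
  [/\ span (range z) u, P p & s *: x = w + u + t *: p]].

Let ST t : S t -> exists s w, T t s w.
Proof.
move=> [s [p [ss Pp /spanUP[w [u [Nw zu e]]]]]]; exists s, w; split=> //.
  exact: span_id Nw.
by exists u, p; rewrite -e subrK.
Qed.

Let TS t s w : T t s w -> S t.
Proof.
move=> [ss Nw [u [p [zu Pp e]]]]; exists s, p; split=> //.
rewrite e addrK; apply/spanUP; exists w, u; split=> //; exact: span_gen.
Qed.

Let good t j := exists s w s' d, [/\ T t s w, Sg s' & s' * phi j w = t * d].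

(* Two approximations of [x] modulo [t] differ by an element of [t G]; its
   component in the span of [z] is invisible to the coordinates outside the
   countable set of those that do not vanish on [N] intersected with that
   span. *)
Let good_key D t t' s w j :
  (forall v j, N v -> span (range z) v -> ~ D j -> phi j v = 0) ->
  le t t' -> good t' j -> T t s w -> ~ D j ->
  exists2 s3, Sg s3 & exists d, s3 * phi j w = t * d.
Proof.
move=> D0 [s0 ss0 [e se]] [s1 [w1 [s2 [d [T1 ss2 sd]]]]] Tt nD.
have t0 : t != 0 by apply/S_neq0/(TS Tt).
have [ss Nw [u [p [zu Pp sx]]]] := Tt; have [ss1 Nw1 [u1 [p1 [zu1 Pp1 sx1]]]] := T1.
pose y := (s * e) *: p1 - (s0 * s1) *: p.
pose uu := (s0 * s) *: u1 - (s0 * s1) *: u.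
pose ww := (s0 * s1) *: w - (s0 * s) *: w1.
have zuu : span (range z) uu by apply: spanB; apply: spanZ.
have Nww : N ww by apply: submodB => //; apply: submodZ.
have yE : ww = uu + t *: y.
  have : (s0 * s1) *: (s *: x) = (s0 * s) *: (s1 *: x).
    by rewrite !scalerA mulrAC.
  rewrite sx sx1 !scalerDr !scalerA.
  have -> : s0 * s * t' = t * (s * e) by rewrite mulrAC se -mulrA [e * s]mulrC.
  move=> /addr3_eq h; rewrite [ww]h; congr (_ + _).
  by rewrite scalerN scalerA [t * (s0 * s1)]mulrC.
have /spanUP[n [v [Nn zv yE']]] : G y.
  apply: (pG t0); have -> : t *: y = ww - uu by rewrite yE addrC addKr.
  apply/spanUP; exists ww, (- uu); split=> //; first exact: span_gen.
  by rewrite -scaleN1r; apply: spanZ.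
have {}Nn := span_id sN Nn.
have := D0 (ww - t *: n) j _ _ nD.
have [_ phil _] := dbN.
rewrite (linear_onB (phil j))//; last exact: submodZ.
rewrite (linear_onB (phil j))//; try exact: submodZ.
rewrite !(linear_onZ _ sN (phil j))// => h.
exists (s2 * (s0 * s1)); first by do !apply: SgM.
exists (s * e * d + s2 * phi j n).
rewrite -mulrA; have -> : s0 * s1 * phi j w = s0 * s * phi j w1 + t * phi j n.
  apply/eqP; rewrite -subr_eq -subr_eq0 addrAC h ?eqxx//.
    by apply: submodB => //; apply: submodZ.
  rewrite yE yE' scalerDr addrA addrAC addrK.
  by apply: spanD => //; apply: spanZ.
rewrite !mulrDr; congr (_ + _); last by rewrite mulrCA.
by rewrite mulrCA sd mulrACA se -[LHS]mulrA [e * _]mulrCA -[s * e * d]mulrA.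
Qed.

(** Infinitely many bad coordinates [f n], each bad for some [tau n], would have a common bound [t].
    A coordinate vanishing at an approximation [w] for [t] is good for [t], hence for [tau n]; so
    every [f n] would lie in the finite support of [w]. *)
Let good_cofinite D :
  (forall v j, N v -> span (range z) v -> ~ D j -> phi j v = 0) ->
  exists LW : seq X, forall t j, S t -> ~ D j -> j \notin LW -> good t j.
Proof.
move=> D0; pose W : set X := [set j | ~ D j /\ exists t, S t /\ ~ good t j].
have [/finite_seqP[LW WE]|/infiniteP/card_leP[f0]] := pselect (finite_set W).
  exists LW => t j St nD jLW; apply: contrapT => ng.
  have : W j by split=> //; exists t.
  by rewrite WE /= (negPf jLW).
pose f n := \val (f0 (to_setT n)).
have fW n : W (f n) by exact: set_valP.
have /choice[tau tauP] : forall n, exists t, S t /\ ~ good t (f n).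
  by move=> n; have [_] := fW n.
have [n|t St tt] := S_bounded (tau := tau); first by have [] := tauP n.
have [s [w Tt]] := ST St; have [_ Nw _] := Tt.
have [_ _ /(_ w Nw)[l [_ lP _]]] := dbN.
have fl n : f n \in l.
  apply: lP; apply/eqP => fw0; have [Sn ng] := tauP n; apply: ng.
  have gt : good t (f n) by exists s, w, 1, 0; rewrite fw0 !mulr0.
  have [s' [w' Tn]] := ST Sn; have [nD _] := fW n.
  have [s3 ss3 [d ed]] := good_key D0 (tt n) gt Tn nD.
  by exists s', w', s3, d.
have fi : injective f.
  by move=> m n /val_inj/inj; rewrite !inE => /(_ I I)/(congr1 val).
have : (size [seq f n | n <- iota 0 (size l).+1] <= size l)%N.
  apply: uniq_leq_size; first by rewrite map_inj_uniq ?iota_uniq.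
  by move=> _ /mapP[n _ ->].
by rewrite size_map size_iota ltnn.
Qed.

(** By [good_key], a coordinate outside [D] and [LW] is locally divisible by [t], so its term moves
    into [t *: n]; the denominators multiply along the list. *)
Let support_sum D (LW : seq X) t s w (l : seq X) :
  (forall v j, N v -> span (range z) v -> ~ D j -> phi j v = 0) ->
  (forall t j, S t -> ~ D j -> j \notin LW -> good t j) ->
  T t s w ->
  exists s1 v n, [/\ Sg s1, N n, span [set b j | j in [set j | D j \/ j \in LW]] v &
    s1 *: (\sum_(j <- l) phi j w *: b j) = v + t *: n].
Proof.
move=> D0 LWP Tt; elim: l => [|j l [s1 [v [n [ss1 Nn vQ e]]]]].
  exists 1, 0, 0; split=> //; [by case: sN|exact: span0|].
  by rewrite big_nil !scaler0 addr0.
have [Nb _ _] := dbN; have St := TS Tt.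
have [jQ|/not_orP[nD /negP nLW]] := pselect (D j \/ j \in LW).
  exists s1, ((s1 * phi j w) *: b j + v), n; split=> //.
    by apply: span_lin => //; apply: span_gen; exists j.
  by rewrite big_cons scalerDr scalerA e addrA.
have le_tt : le t t by exists 1 => //; exists 1; rewrite mulrC.
have [s3 ss3 [d ed]] := good_key D0 le_tt (LWP t j St nD nLW) Tt nD.
exists (s3 * s1), (s3 *: v), ((s1 * d) *: b j + s3 *: n); split.
- exact: SgM.
- by apply: submodD => //; apply: submodZ.
- exact: spanZ.
- rewrite big_cons scalerDr -[in X in _ + X]scalerA e !scalerDr !scalerA addrCA.
  congr (_ + (_ *: _ + _ *: _)); last by rewrite mulrC.
  by rewrite mulrAC ed -mulrA [d * s1]mulrC.
Qed.

Let le_min a0 (l : seq R) :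
  exists2 c, c \in a0 :: l & forall y, y \in a0 :: l -> le c y.
Proof.
have le_refl a : le a a by exists 1 => //; exists 1; rewrite mulrC.
elim: l => [|a l [c cl cmin]].
  by exists a0; rewrite ?mem_head// => y; rewrite inE => /eqP->.
have [ca|ac] := le_total c a; [exists c|exists a].
- by move: cl; rewrite !in_cons => /orP[->//|->]; rewrite !orbT.
- move=> y; rewrite !in_cons orbCA => /orP[/eqP->//|yl].
  by apply: cmin; rewrite in_cons.
- by rewrite !in_cons eqxx orbT.
- move=> y; rewrite !in_cons orbCA => /orP[/eqP->//|yl].
  by apply: le_trans ac _; apply: cmin; rewrite in_cons.
Qed.

(* Once [x] is approximated from a finite set, splitting off its pure closure
   turns the approximations into genuine divisibility of a nonzero element of
   [P], whose coordinates have a common divisor of largest possible value. *)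
Let cofinal_of_finite (Q : seq U) : (forall v, v \in Q -> G v) ->
  (forall t, S t -> exists s p, [/\ Sg s, P p & span [set` Q] (s *: x - t *: p)]) ->
  exists2 c, S c & forall t, S t -> le t c.
Proof.
move=> QG Qx; have QP v : v \in Q -> P v by move=> /QG/GP.
have [I [f [d [fl Pd Qd fE]]]] := pure_projection prR tf sP lpP QP.
pose pi p := \sum_i f i p *: d i.
have Ppi p : P (pi p) by apply: submod_sum => // i _; apply: submodZ.
have Gpi p : G (pi p).
  apply: submod_sum => // i _; apply: submodZ => //.
  by apply: purif_sub (Qd i).
have piL c u v : P u -> P v -> pi (c *: u + v) = c *: pi u + pi v.
  by move=> Pu Pv; rewrite /pi (sum_linear _ _ fl).
have piZ c u : P u -> pi (c *: u) = c *: pi u.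
  by move=> Pu; rewrite /pi (sum_scale _ _ sP fl).
pose x' := x - pi x.
have Px' : P x' by apply: submodB.
have [k [psi [bb [psil Pbb x'E]]]] := lpP Px'.
(* [c] is a coordinate of [x'] that locally divides all the others. With no coordinates at all, [x']
   would vanish and [x] would lie in [G]. *)
have [c cpsi cmin] : exists2 c, c \in codom (psi ^~ x') &
    forall i, le c (psi i x').
  case E : (codom (psi ^~ x')) => [|a0 l].
    case: xG; have k0 : k = 0%N.
      by have := congr1 size E; rewrite size_codom card_ord.
    have : x' = 0.
      rewrite x'E; apply: big1 => i _; have := ltn_ord i.
      by rewrite {2}k0 ltn0.
    by move=> /eqP; rewrite subr_eq0 => /eqP->.
  have [c cl cmin] := le_min a0 l; exists c => // i; apply: cmin.
  by rewrite -E; exact: codom_f.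
have [i0 cE] := codomP cpsi.
exists c => [|t St].
  pose H := [set u | exists s y, [/\ Sg s, P y & s *: u = c *: y]].
  have sH : submod H.
    split; first by exists 1, 0; rewrite !scaler0; split=> //; case: sP.
    move=> a u v [s [y [ss Py e]]] [s' [y' [ss' Py' e']]].
    exists (s * s'), ((s' * a) *: y + s *: y'); split; first exact: SgM.
      by apply: submodD => //; apply: submodZ.
    rewrite !scalerDr !scalerA; congr (_ + _).
      have -> : s * s' * a = s' * a * s by rewrite -mulrA mulrC.
      by rewrite -scalerA e scalerA mulrC.
    by rewrite -scalerA e' scalerA mulrC.
  have : H x'.
    rewrite x'E; apply: submod_sum => // i _.
    have [s ss [e ee]] := cmin i; exists s, (e *: bb i); split=> //.
      exact: submodZ.
    by rewrite !scalerA ee.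
  move=> [s [y [ss Py e]]]; exists s, y; split=> //.
  by rewrite -e scalerBr subKr; apply: submodZ.
have [s [p [ss Pp Qe]]] := Qx t St.
have Pe : P (s *: x - t *: p) by apply: submodB => //; apply: submodZ.
have e : s *: x' = t *: (p - pi p).
  have := fE _ Pe (span_purif Qe); rewrite -/(pi _) addrC -scaleNr piL//; last first.
    exact: submodZ.
  rewrite piZ// scaleNr addrC scaleNr => /eqP.
  rewrite subr_eq addrAC -subr_eq => /eqP.
  rewrite scalerBr => ->.
  by rewrite scalerBr addrC.
(* Applying [psi i0] turns divisibility of [s *: x'] by [t] into divisibility of [s * c]. *)
exists s => //; exists (psi i0 (p - pi p)).
rewrite cE -!(linear_onZ _ sP (psil i0))// ?e//.
exact: submodB.
Qed.

(** For each [t], finitely many of the [z] and of the basis vectors with coordinate in [D] or [LW]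
    approximate [x]. As [LW] is finite and [D] is exhausted by the lists [L i], these sets grow
    through the stages [Q i]; [uniform] finds one stage for all [t]. *)
Lemma bounded_cofinal : exists2 c, S c & forall t, S t -> le t c.
Proof.
have /choice[L LP] : forall i, exists L : seq X,
    forall v j, N v -> span [set` [seq z j | j <- iota 0 i]] v ->
      j \notin L -> phi j v = 0.
  move=> i; have lpN := dual_basis_locally_projective dbN.
  have [E [EN EP]] := span_capture [seq z j | j <- iota 0 i] prR tf sN lpN.
  have [L LP] := dual_basis_support sN dbN EN.
  by exists L => v j Nv zv; apply: LP; exact: EP.
pose D j := exists i, j \in L i.
have D0 v j : N v -> span (range z) v -> ~ D j -> phi j v = 0.
  move=> Nv /span_range[i zv] nD; apply: (LP i) => //.
  by apply/negP => jL; apply: nD; exists i.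
have [LW LWP] := good_cofinite D0.
pose Q i := [seq z j | j <- iota 0 i] ++
  [seq b j | j <- flatten [seq L m | m <- iota 0 i] ++ LW].
have iotaS i j m : (i <= j)%N -> m \in iota 0 i -> m \in iota 0 j.
  by rewrite !mem_iota !add0n => ij /leq_trans; apply.
have QS i j : (i <= j)%N -> [set` Q i] `<=` [set` Q j].
  move=> ij v /=; rewrite !mem_cat => /orP[/mapP[m mi ->]|/mapP[m]].
    by apply/orP; left; apply: map_f; apply: iotaS mi.
  rewrite mem_cat => mi ->; apply/orP; right; apply: map_f; rewrite mem_cat.
  case/orP: mi => [/flattenP[_ /mapP[a ai ->] ma]|->]; last by rewrite orbT.
  apply/orP; left; apply/flattenP; exists (L a) => //.
  by apply: map_f; apply: iotaS ai.
have [Nb _ phiP] := dbN.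
have QG i v : v \in Q i -> G v.
  rewrite mem_cat => /orP[/mapP[m _ ->]|/mapP[m _ ->]]; apply: span_gen.
    by right; exists m.
  by left.
pose Si i t := exists s p, [/\ Sg s, P p & span [set` Q i] (s *: x - t *: p)].
have [t St|i t t' [s0 ss0 [d e]] [s [p [ss Pp Qp]]]|i Qi] := @uniform Si.
- have [s [w Tt]] := ST St; have [ss Nw [u [p [zu Pp e]]]] := Tt.
  have [l [_ _ wE]] := phiP w Nw.
  have [s1 [v [n [ss1 Nn vQ wn]]]] := support_sum l D0 LWP Tt.
  have : span (\bigcup_i [set` Q i]) (s1 *: u + v).
    apply: spanD.
      apply: spanZ; apply: span_mono zu => _ [m _ <-]; exists m.+1 => //=.
      rewrite mem_cat; apply/orP; left; apply/mapP; exists m => //.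
      by rewrite mem_iota add0n ltnSn.
    apply: span_mono vQ => _ [j [[m jm]|jm] <-]; [exists m.+1|exists 0%N] => //.
      rewrite /mkset mem_cat; apply/orP; right; apply: map_f.
      rewrite mem_cat; apply/orP; left; apply/flattenP; exists (L m) => //.
      by apply/mapP; exists m => //; rewrite mem_iota add0n ltnSn.
    by rewrite /mkset mem_cat; apply/orP; right; apply: map_f; rewrite mem_cat jm orbT.
  move=> /(span_chain QS)[i Qi]; exists i, (s1 * s), (s1 *: p + n); split.
  + exact: SgM.
  + by apply: submodD => //; [apply: submodZ|apply: NP].
  + rewrite -scalerA e {1}wE !scalerDr wn !scalerA [t * s1]mulrC.
    rewrite [X in span _ X](_ : _ = s1 *: u + v)//.
    apply/eqP; rewrite subr_eq; apply/eqP.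
    by rewrite !addrA (ACl (3*1*4*2)%AC).
- exists (s0 * s), (d *: p); split; [exact: SgM|exact: submodZ|].
  have -> : (s0 * s) *: x - t *: (d *: p) = s0 *: (s *: x - t' *: p).
    by rewrite scalerBr !scalerA e.
  exact: spanZ.
exact: (cofinal_of_finite (QG i) Qi).
Qed.

End Bounded.

(** If no sequence is cofinal in [S], totality bounds every sequence, and the maximum from
    [bounded_cofinal] gives a constant cofinal one. *)
Lemma local_generators : exists k : nat -> U,
  (forall i, purif ((N `|` range z) `|` [set x]) (k i)) /\
  forall p r, r != 0 -> span ((N `|` range z) `|` [set x]) (r *: p) ->
    exists2 s, Sg s & span ((N `|` range z) `|` range k) (s *: p).
Proof.
have [[tau [tauS tauC]]|no] := pselect (exists tau : nat -> R,
    (forall i, S (tau i)) /\ forall t, S t -> exists i, le t (tau i)).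
  exact: cofinal_generators tauS tauC.
have [|c Sc cmax] := bounded_cofinal; last first.
  by apply: (@cofinal_generators (fun=> c)) => // t /cmax; exists 0%N.
move=> tau tauS; apply: contrapT => nb; apply: no; exists tau; split=> // t St.
apply: contrapT => /forallNP nle; apply: nb; exists t => // i.
by have [//|/nle] := le_total (tau i) t.
Qed.

End LocalStep.

(** * Maximal ideals and local divisibility *)

Section MaximalIdeals.
Variable R : idomainType.

Lemma exists_maximal_ideal (D : set R^o) : submod D -> ~ D 1 ->
  exists2 I : ideal R, maximal_ideal I & forall x, D x -> x \in I.
Proof.
move=> sD D1.
have [|F [X0 FX0] FQ Ftot|A [[sA A1] DA Amax]] :=
    @Zorn_union R^o [set X | submod X /\ ~ X 1] D; first by [].
  split; last by move=> [X FX X1]; have [_] := FQ X FX; apply.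
  split; first by exists X0 => //; have [[]] := FQ X0 FX0.
  move=> c u v [X FX Xu] [Y FY Yv].
  have [XY|YX] := Ftot X Y FX FY.
    by exists Y => //; have [[_ YL] _] := FQ Y FY; apply: YL => //; exact: XY.
  by exists X => //; have [[_ XL] _] := FQ X FX; apply: XL => //; exact: YX.
have [I IA] := submodClosed_pack sA.
exists I => [|x /DA/IA//]; split=> [|J IJ]; first by apply/negP => /IA.
have sJ : submod [set x | x \in J].
  by split=> [|c u v uJ vJ]; [exact: rpred0|apply: rpredD => //; exact: rpredZ].
have [J1|J1] := boolP ((1 : R^o) \in J).
  by right=> x; rewrite -[x]mulr1; exact: (rpredZ (x : R) J1).
left=> x; apply/idP/idP => [xJ|]; last exact: IJ.
apply/IA; apply: (Amax [set x | x \in J]) => //=.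
  by split=> //; exact/negP.
by move=> y /IA/IJ.
Qed.

Lemma maximal_ideal_prime (I : ideal R) (s t : R) : maximal_ideal I ->
  s \notin I -> t \notin I -> s * t \notin I.
Proof.
move=> [I1 Imax] sI tI; apply/negP => stI.
(* This set is the ideal generated by [I] and [s]. *)
have sD : submod [set a : R^o | exists r : R, (a - r * s : R^o) \in I].
  split; first by exists 0; rewrite mul0r subr0; exact: rpred0.
  move=> c u v [a au] [a' av]; exists (c * a + a').
  rewrite mulrDl opprD addrACA -mulrA; apply: rpredD => //.
  by have := rpredZ c au; rewrite scalerBr.
have [J JD] := submodClosed_pack sD.
have [x xI|JI|J1] := Imax J.
- by apply/JD; exists 0; rewrite mul0r subr0.
- move/negP: sI; apply; rewrite -JI; apply/JD; exists 1.
  by rewrite mul1r subrr; exact: rpred0.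
- have /JD[r rs] := J1 1; move/negP: tI; apply.
  rewrite -[t](subrK (r * (s * t))).
  apply: rpredD; last exact: (rpredZ r stI).
  by have := rpredZ t rs; rewrite scalerBr /GRing.scale /= mulr1 mulrCA [t * s]mulrC.
Qed.

(** Since [s + t = 1] in [prufer_local], one of the two lies outside [I]. *)
Lemma maximal_ideal_local (I : ideal R) (a c : R) : prufer_domain R ->
  maximal_ideal I -> exists2 s, s \notin I &
    (exists d, s * c = a * d) \/ (exists d, s * a = c * d).
Proof.
move=> prR [I1 _]; have [s [t [u [v [st su tv]]]]] := prufer_local prR a c.
have [sI|sI] := boolP (s \in I); last by exists s => //; left; exists u.
exists t; last by right; exists v.
apply: contra I1 => tI; rewrite -st; exact: rpredD.
Qed.

End MaximalIdeals.

Lemma range_pair (T : Type) (k : nat -> nat -> T) :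
  exists k' : nat -> T, forall x, range k' x <-> exists n, range (k n) x.
Proof.
exists (fun m => let a := odflt (0%N, 0%N) (unpickle m) in k a.1 a.2) => x.
split=> [[m _ <-]|[n [i _ <-]]]; first by eexists; eexists.
by exists (pickle (n, i)) => //; rewrite pickleK.
Qed.

Lemma range_merge (T : Type) (z k : nat -> T) :
  exists z' : nat -> T, range z' = range z `|` range k.
Proof.
have [z' zP] := range_pair (fun n => if n is 0%N then z else k).
exists z'; apply/seteqP; split=> [y /zP[[|n] h]|y [h|h]]; [by left|by right| |].
  by apply/zP; exists 0%N.
by apply/zP; exists 1%N.
Qed.

(** * From the maximal ideals to global generators *)

Section CountableGeneration.
Variables (R : idomainType) (U : lmodType R) (N P : set U).
Variables (X : choiceType) (b : X -> U) (phi : X -> U -> R).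
Hypotheses (prR : prufer_domain R).
Hypothesis maxR : countable [set I : ideal R | maximal_ideal I].
Hypotheses (tf : torsion_free U).
Hypotheses (sN : submod N) (sP : submod P) (NP : N `<=` P).
Hypotheses (pN : pure N) (pP : pure P).
Hypotheses (dbN : dual_basis N b phi) (lpP : locally_projective P).

(** The local generators for all maximal ideals are collected. The multipliers carrying [p] into
    their span form an ideal contained in no maximal ideal, so 1 is among them. *)
Lemma countable_generators_step (z : nat -> U) (x : U) :
  (forall i, P (z i)) -> pure (span (N `|` range z)) -> P x ->
  exists k : nat -> U,
    (forall i, purif ((N `|` range z) `|` [set x]) (k i)) /\
    forall p r, r != 0 -> span ((N `|` range z) `|` [set x]) (r *: p) ->
      span ((N `|` range z) `|` range k) p.
Proof.
move=> zP pG xP; set Nz := N `|` range z in pG *.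
have [xG|xG] := pselect (span Nz x).
  exists (fun=> 0); split=> [i|p r r0 rp].
    by case: (submod_purif (Nz `|` [set x])).
  suff : span Nz p by apply: span_mono => y; left.
  apply: (pG r) => //; apply: span_sub rp; first exact: submod_span.
  by move=> y [|->] //; exact: span_gen.
have /countable_injP[f fI] := maxR.
have /choice[k kP] : forall n, exists k : nat -> U,
    (forall i, purif (Nz `|` [set x]) (k i)) /\
    forall I : ideal R, maximal_ideal I -> f I = n ->
    forall p r, r != 0 -> span (Nz `|` [set x]) (r *: p) ->
      exists2 s, s \notin I & span (Nz `|` range k) (s *: p).
  move=> n; have [[I [mI <-]]|no] := pselect (exists I, maximal_ideal I /\ f I = n);
      last first.
    exists (fun=> 0); split=> [i|I mI fn].
      by case: (submod_purif (Nz `|` [set x])).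
    by case: no; exists I.
  have [||||k [kx kP]] := @local_generators R U N P z x X b phi
    [set s | s \notin I] prR tf sN sP NP pP dbN lpP zP pG xP xG.
  - by case: mI.
  - by move=> s t; exact: maximal_ideal_prime.
  - by apply/negP; rewrite negbK rpred0.
  - by move=> a c; apply: maximal_ideal_local.
  exists k; split=> // J mJ /fI JI; have -> : J = I by apply: JI; rewrite inE.
  exact: kP.
have [k' k'E] := range_pair k.
exists k'; split=> [i|p r r0 rp].
  have /k'E[n [j _ <-]] : range k' (k' i) by exists i.
  by have [] := kP n.
pose D : set R^o := [set s : R | span (Nz `|` range k') (s *: p)].
have sD : submod D.
  split; first by rewrite /D /= scale0r; exact: span0.
  by move=> c u v Du Dv; rewrite /D /= scalerDl -scalerA; exact: span_lin.
have [D1|D1] := pselect (D 1); first by move: D1; rewrite /D /= scale1r.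
have [I mI DI] := exists_maximal_ideal sD D1.
have [_ kI] := kP (f I); have [s sI sp] := kI I mI erefl p r r0 rp.
case/negP: sI; apply: DI; apply: span_mono sp => y [|ky]; first by left.
by right; apply/k'E; exists (f I).
Qed.

Lemma countable_generators (F : seq U) : (forall v, v \in F -> P v) ->
  exists z : nat -> U, [/\ forall i, P (z i), pure (span (N `|` range z)) &
    forall v, v \in F -> span (N `|` range z) v].
Proof.
elim: F => [|e F IH] FP.
  have N0 : N `|` range (fun _ : nat => 0) `<=` N by move=> v [//|[_ _ <-]]; case: sN.
  exists (fun=> 0); split=> // [i|r p r0 rp]; first by case: sP.
  by apply: span_gen; left; apply: (pN r0); apply: span_sub rp.
have [|z [zP pG FG]] := IH; first by move=> v vF; apply: FP; rewrite in_cons vF orbT.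
have eP : P e by apply: FP; rewrite mem_head.
have [k [kx kP]] := countable_generators_step zP pG eP.
have [z' z'E] := range_merge z k.
have Nzk : N `|` range z' = (N `|` range z) `|` range k by rewrite z'E setUA.
have subP : (N `|` range z) `|` [set e] `<=` P.
  by move=> v [[/NP|[i _ <-]]|->].
exists z'; rewrite Nzk; split=> [i|r p r0 rp|v].
- have : range z' (z' i) by exists i.
  by rewrite z'E => -[[j _ <-]//|[j _ <-]]; apply: purif_sub (kx j).
(* The new generators lie in the pure closure of the old ones and [e], so some nonzero multiple of
   [r *: p] is within reach of [kP]. *)
- have [|s s0 srp] := @span_sub _ _ _ (purif ((N `|` range z) `|` [set e]))
      (submod_purif _) _ _ rp.
    by move=> v [Nv|[i _ <-]] //; apply/span_purif/span_gen; left.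
  by apply: (kP p (s * r)); rewrite ?mulf_neq0// -scalerA.
- rewrite in_cons => /predU1P[->|/FG]; last by apply: span_mono => y; left.
  apply: (kP e 1); rewrite ?oner_neq0// scale1r; apply: span_gen; by right.
Qed.

End CountableGeneration.

(** * Partial lifts *)

Section SpanQuotient.
Variables (R : idomainType) (M U : lmodType R) (q : {linear M -> U}) (A : set M).
Hypotheses (sA : submod A) (kerq : forall x, q x = 0 <-> A x).

Lemma span_quotient (S : set M) v : span (q @` S) (q v) <-> span (A `|` S) v.
Proof.
split=> [qSv|ASv].
  have lift w : span (q @` S) w -> exists2 u, q u = w & span S u.
    elim=> {w} [_ [u Su <-]||c _ _ _ [u <- Su] _ [u' <- Su']].
    - by exists u => //; exact: span_gen.
    - by exists 0; [exact: linear0|exact: span0].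
    - by exists (c *: u + u'); [exact: linearP|exact: span_lin].
  have [u /esym/eqP] := lift _ qSv.
  rewrite -subr_eq0 -raddfB => /eqP/kerq Avu Su.
  by apply/spanUP; exists (v - u), u; split; [exact: span_gen| |rewrite subrK].
have /spanUP[a [u [/(span_id sA)/kerq Aa Su ->]]] := ASv.
rewrite linearD Aa add0r; elim: Su => {u} [u Su||c u u' _ qu _ qu'].
- by apply: span_gen; exists u.
- by rewrite linear0; exact: span0.
- by rewrite linearP; exact: span_lin.
Qed.

Lemma purif_quotient (S : set M) v : purif (q @` S) (q v) <-> purif (A `|` S) v.
Proof.
by split=> -[r r0 rv]; exists r => //; [apply/span_quotient|]; rewrite ?linearZ//;
  rewrite -linearZ; apply/span_quotient.
Qed.

End SpanQuotient.

Section Lifts.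
Variables (R : idomainType) (M A B : lmodType R).
Variables (g : {linear A -> B}) (f : {linear M -> B}).
Hypothesis g_surj : forall y, exists x, g x = y.
Implicit Types (G : set (M * A)) (C : set M).

(* Lifts defined on a submodule are encoded by their graphs, so that the common
   extension of a chain of lifts is a union of sets. *)
Definition partial_lift G :=
  [/\ G (0, 0),
      forall c u y v w, G (u, y) -> G (v, w) -> G (c *: u + v, c *: y + w),
      forall x y y', G (x, y) -> G (x, y') -> y = y' &
      forall x y, G (x, y) -> g y = f x].

Definition dom G : set M := [set x | exists y, G (x, y)].

Lemma submod_dom G : partial_lift G -> submod (dom G).
Proof.
move=> [G0 GL _ _]; split; first by exists 0.
by move=> c u v [y Gu] [w Gv]; exists (c *: y + w); exact: GL.
Qed.

Lemma partial_lift_union (F : set (set (M * A))) :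
  F !=set0 -> F `<=` partial_lift -> total_on F subset ->
  partial_lift (\bigcup_(G in F) G).
Proof.
move=> [G0 FG0] FL Ftot; split.
- by exists G0 => //; have [] := FL _ FG0.
- move=> c u y v w [G FG Gu] [H FH Hv].
  have [GH|HG] := Ftot _ _ FG FH.
    by exists H => //; have [_ HL _ _] := FL _ FH; apply: HL => //; exact: GH.
  by exists G => //; have [_ GL _ _] := FL _ FG; apply: GL => //; exact: HG.
- move=> x y y' [G FG Gx] [H FH Hx].
  have [GH|HG] := Ftot _ _ FG FH.
    by have [_ _ Hf _] := FL _ FH; apply: Hf Hx; exact: GH.
  by have [_ _ Gf _] := FL _ FG; apply: Gf Gx _; exact: HG.
- by move=> x y [G FG Gx]; have [_ _ _] := FL _ FG; apply.
Qed.

(** Subtracting the expansion of [x] along [phi] and [b] projects [C] onto [dom G]. The new value at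
    [x] is that of [G] at the projection plus the same combination of arbitrary preimages [y i] of
    the [f (b i)]. *)
Lemma partial_lift_extend G C (I : finType) (phi : I -> M -> R) (b : I -> M) :
  partial_lift G -> submod C -> dom G `<=` C ->
  (forall i, linear_on C (phi i)) ->
  (forall i x, dom G x -> phi i x = 0) ->
  (forall x, C x -> dom G (x - \sum_i phi i x *: b i)) ->
  exists G', [/\ partial_lift G', G `<=` G' & dom G' = C].
Proof.
move=> GP sC GC phil phi0 phiC; have [G0 GL Gf Gg] := GP.
have /choice[y yE] : forall i, exists y, g y = f (b i) by move=> i; exact: g_surj.
pose rest x := x - \sum_i phi i x *: b i.
pose val x a := a + \sum_i phi i x *: y i.
exists [set xa | C xa.1 /\ exists2 a, G (rest xa.1, a) & xa.2 = val xa.1 a]; split.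
- split.
  + split=> /=; first by case: sC.
    exists 0; rewrite /rest /val; last first.
      by rewrite big1 ?addr0// => i _; rewrite (linear_on0 sC (phil i)) scale0r.
    by rewrite big1 ?subr0// => i _; rewrite (linear_on0 sC (phil i)) scale0r.
  + move=> c u w u' w' /= [Cu [a Ga ->]] [Cu' [a' Ga' ->]].
    split; first by case: sC => _; apply.
    exists (c *: a + a').
      rewrite /rest (sum_linear _ _ phil)// opprD addrACA -scalerBr.
      exact: GL.
    by rewrite /val (sum_linear _ _ phil)// scalerDr addrACA.
  + move=> x w w' /= [_ [a Ga ->]] [_ [a' Ga' ->]].
    by rewrite (Gf _ _ _ Ga Ga').
  + move=> x w /= [_ [a Ga ->]]; rewrite /val linearD (Gg _ _ Ga) /rest.
    rewrite linearB !linear_sum -[RHS]addr0 -addrA; congr (_ + _).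
    rewrite -big_split big1// => i _; rewrite [f _]linearZ [g _]linearZ yE.
    exact: addNr.
- move=> [x a] Ga /=; have dx : dom G x by exists a.
  split; first exact: GC.
  exists a; rewrite /rest /val big1 ?subr0 ?addr0// => i _.
    by rewrite phi0// scale0r.
  by rewrite phi0// scale0r.
- apply/seteqP; split=> [x [w [//]]|x Cx].
  by have [a Ga] := phiC x Cx; exists (val x a); split=> //; exists a.
Qed.

Lemma partial_lift_chain (C : nat -> set M) G0 :
  (forall k G, partial_lift G -> dom G = C k ->
     exists G', [/\ partial_lift G', G `<=` G' & dom G' = C k.+1]) ->
  partial_lift G0 -> dom G0 = C 0%N ->
  exists G, [/\ partial_lift G, G0 `<=` G & dom G = \bigcup_k C k].
Proof.
move=> ext G0P G0C.
(* The extension is chosen for all pairs, valid or not, so that [Gk] is an ordinary recursion;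
   validity follows by induction. *)
have /choice[e eP] : forall kG : nat * set (M * A), exists G',
    partial_lift kG.2 -> dom kG.2 = C kG.1 ->
    [/\ partial_lift G', kG.2 `<=` G' & dom G' = C kG.1.+1].
  move=> [k G]; have [[GP GC]|no] := pselect (partial_lift G /\ dom G = C k).
    by have [G' ?] := ext k G GP GC; exists G'.
  by exists G => /= GP GC; case: no.
pose Gk := fix Gk k := if k is k'.+1 then e (k', Gk k') else G0.
have GkP k : partial_lift (Gk k) /\ dom (Gk k) = C k.
  by elim: k => //= k [GP GC]; have [] := eP (k, Gk k) GP GC.
have GkS k : Gk k `<=` Gk k.+1.
  by have [GP GC] := GkP k; have [] := eP (k, Gk k) GP GC.
have Gkm i j : (i <= j)%N -> Gk i `<=` Gk j.
  move=> /subnK <-; elim: (j - i)%N => [|d IH] //= y /IH; exact: GkS.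
exists (\bigcup_k Gk k); split; last 2 first.
- by move=> y G0y; exists 0%N.
- apply/seteqP; split=> [x [y [k _ Gx]]|x [k _]].
    by exists k => //; have [_ <-] := GkP k; exists y.
  by have [_ <-] := GkP k => -[y Gx]; exists y, k.
have -> : \bigcup_k Gk k = \bigcup_(G in range Gk) G by rewrite bigcup_image.
apply: partial_lift_union; first by exists G0; exists 0%N.
  by move=> _ [k _ <-]; have [] := GkP k.
move=> _ _ [i _ <-] [j _ <-].
by case/orP: (leq_total i j) => ij; [left|right]; exact: Gkm.
Qed.

End Lifts.

(* The elements generated from [x0] under [K] are the values of terms, and there
   are only countably many terms. *)
Section Closure.
Variables (T : Type) (x0 : T) (K : seq T -> nat -> T).

Fixpoint tree_value (t : GenTree.tree unit) : T :=
  match t with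
  | GenTree.Leaf _ => x0
  | GenTree.Node n ts => K [seq tree_value t | t <- ts] n
  end.

End Closure.

Lemma countable_closure (T : eqType) (x0 : T) (K : seq T -> nat -> T) :
  exists Z : nat -> T, range Z x0 /\
    forall F : seq T, (forall v, v \in F -> range Z v) ->
      forall n, range Z (K F n).
Proof.
pose val := tree_value x0 K.
pose Z m := if unpickle m is Some t then val t else x0.
have ZP v : range Z v <-> exists t, val t = v.
  split=> [[m _ <-]|[t <-]]; last by exists (pickle t) => //; rewrite /Z pickleK.
  by rewrite /Z; case: unpickle => [t|]; [exists t|exists (GenTree.Leaf tt)].
exists Z; split=> [|F FZ n]; first by apply/ZP; exists (GenTree.Leaf tt).
suff [ts ->] : exists ts, F = [seq val t | t <- ts].
  by apply/ZP; exists (GenTree.Node n ts).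
elim: F FZ => [|v F IH] FZ; first by exists [::].
have [|ts ->] := IH; first by move=> w wF; apply: FZ; rewrite in_cons wF orbT.
by have /ZP[t <-] := FZ v (mem_head _ _); exists (t :: ts).
Qed.

(** * Hill's class of submodules *)

Section Hill.
Variables (R : idomainType) (M : lmodType R) (N : nat -> set M).
Variables (X : nat -> choiceType) (b : forall n, X n -> M).
Variable phi : forall n, X n -> M -> R.
Hypotheses (prR : prufer_domain R).
Hypothesis maxR : countable [set I : ideal R | maximal_ideal I].
Hypotheses (sN : forall n, submod (N n)) (N0 : forall x, N 0%N x -> x = 0).
Hypotheses (NS : forall n, N n `<=` N n.+1) (Ncov : forall x, exists n, N n x).
Hypothesis dbN : forall n, dual_basis (N n) (@b n) (@phi n).
Implicit Types (A B : set M) (F : seq M).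

(* The second clause makes the basis vectors of [N n] lying in [A] span a direct
   summand, namely [A `&` N n]; by the third one the images of the [N n] are
   pure in [M / A]. Both clauses are preserved by unions of chains. *)
Definition hill A :=
  [/\ submod A,
      forall n a j, A a -> N n a -> phi j a != 0 -> A (@b n j) &
      forall n, pure (span (A `|` N n))].

Let Nmono i j : (i <= j)%N -> N i `<=` N j.
Proof.
by move=> /subnK <-; elim: (j - i)%N => [|d IH] //= y /IH; exact: NS.
Qed.

Let NF F : exists n, forall v, v \in F -> N n v.
Proof.
elim: F => [|v F [n FN]]; first by exists 0%N.
have [m vN] := Ncov v; exists (maxn m n) => w.
rewrite in_cons => /predU1P[->|/FN Nw].
  exact: (Nmono (leq_maxl m n)).
exact: (Nmono (leq_maxr m n)).
Qed.

(** This is the third clause of [hill] at index 0, where [N 0] is zero. *)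
Lemma hill_pure A : hill A -> pure A.
Proof.
move=> [sA _ pA] r p r0 rp; have : span (A `|` N 0%N) p.
  by apply: (pA _ _ _ r0); apply: span_gen; left.
by apply: span_sub => // v [//|/N0->]; case: sA.
Qed.

(** Coordinates whose basis vector lies in [A] are discarded. By the second clause of [hill] the
    others vanish on the elements of [A] in [N n], so they descend to the quotient; the third clause
    makes the images pure. *)
Lemma hill_quotient A : hill A -> exists (U : lmodType R) (q : {linear M -> U}),
  [/\ forall u, exists x, q x = u, forall x, q x = 0 <-> A x, torsion_free U &
    forall n, [/\ submod (q @` N n), pure (q @` N n) &
      exists b' phi', @dual_basis R U (q @` N n) (X n) b' phi']].
Proof.
move=> hA; have pA := hill_pure hA; have [sA hA1 hA2] := hA.
have [U [q [qs qk]]] := quotient_exists sA.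
exists U, q; split=> // [r u r0 ru|n].
  have [x xu] := qs u; move: ru; rewrite -xu -linearZ => /qk Arx.
  exact/qk/(pA r).
have sV : submod (q @` N n).
  split; first by exists 0; [case: (sN n)|rewrite linear0].
  move=> c _ _ [u Nu <-] [v Nv <-]; exists (c *: u + v); last exact: linearP.
  by case: (sN n) => _; apply.
split=> // [r u r0 ru|].
  have [x xu] := qs u; rewrite -xu; rewrite -xu -linearZ in ru.
  apply: (span_id sV); apply/(span_quotient sA qk)/(hA2 n r) => //.
  by apply/(span_quotient sA qk); exact: span_gen.
have [Nb phil phiP] := dbN n.
have /choice[lift liftP] : forall u, exists x, (q @` N n) u -> N n x /\ q x = u.
  move=> u; have [[x Nx xu]|no] := pselect ((q @` N n) u); first by exists x.
  by exists 0 => /no.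
pose phi' (j : X n) u := if `[< A (b j) >] then 0 else phi j (lift u).
have phiE (j : X n) x : N n x -> ~ A (b j) -> phi' j (q x) = phi j x.
  move=> Nx nA; rewrite /phi' asboolF//.
  have [|Nl ql] := liftP (q x); first by exists x.
  apply/eqP; rewrite -subr_eq0 -(linear_onB (phil j))//.
  apply: contrapT => /negP d0; apply: nA; apply: hA1 d0.
    by apply/qk; rewrite linearB ql subrr.
  exact: submodB.
exists (fun j => q (b j)), phi'; split=> [j|j c _ _ [u Nu <-] [v Nv <-]|_ [x Nx <-]].
- by exists (b j).
- rewrite -linearP; have [Aj|nA] := pselect (A (b j)).
    by rewrite /phi' !asboolT// mulr0 addr0.
  by rewrite !phiE ?phil//; case: (sN n) => _; apply.
- have [l [ul lP xE]] := phiP x Nx; exists l; split=> // [j|].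
    have [Aj|nA] := pselect (A (b j)); first by rewrite /phi' asboolT// eqxx.
    by rewrite phiE//; apply: lP.
  rewrite {1}xE linear_sum; apply: eq_bigr => j _; rewrite linearZ /=.
  have [Aj|nA] := pselect (A (b j)); last by rewrite phiE.
  by have /qk -> := Aj; rewrite !scaler0.
Qed.

(** What a countable set must contain, for each finite part [F], so that adding it to [A] preserves
    [hill]: the first and third properties serve the clause on basis vectors, the second the purity
    clause. The first two are obtained in the quotient by [A] and lifted. *)
Lemma hill_generators A F : hill A -> exists k : nat -> M,
  [/\ forall n p, N n p -> span (A `|` [set` F]) p ->
        span ((A `&` N n) `|` (range k `&` N n)) p,
      forall n p r, r != 0 -> span ((A `|` N n) `|` [set` F]) (r *: p) ->
        span ((A `|` N n) `|` range k) p &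
      forall n v j, v \in F -> N n v -> phi j v != 0 -> range k (@b n j)].
Proof.
move=> hA; have [sA _ _] := hA.
have [U [q [qs qk tf qN]]] := hill_quotient hA.
have /choice[lift liftP] : forall u, exists x, q x = u by exact: qs.
have FE : q @` [set` F] = [set` [seq q v | v <- F]].
  by apply/seteqP; split=> [_ [v vF <-]|_ /mapP[v vF ->]];
    [apply/mapP; exists v|exists v].
have /choice[E EP] : forall n, exists E : seq M, (forall v, v \in E -> N n v) /\
    forall p, N n p -> span (A `|` [set` F]) p ->
      span ((A `&` N n) `|` [set` E]) p.
  move=> n; have [sV pV [b' [phi' db']]] := qN n.
  have [E [EV EP]] := span_capture [seq q v | v <- F] prR tf sV
    (dual_basis_locally_projective db').
  have [E' [E'N E'E]] : exists E' : seq M, (forall v, v \in E' -> N n v) /\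
      E = [seq q v | v <- E'].
    elim: E EV {EP} => [|v E IH] EV; first by exists [::].
    have [|E' [E'N ->]] := IH; first by move=> w wE; apply: EV; rewrite in_cons wE orbT.
    have [x Nx <-] := EV v (mem_head _ _); exists (x :: E'); split=> // w.
    by rewrite in_cons => /predU1P[->//|/E'N].
  exists E'; split=> // p Np ASp.
  have : span (A `|` [set` E']) p.
    apply/(span_quotient sA qk).
    have -> : q @` [set` E'] = [set` E].
      rewrite E'E; apply/seteqP; split=> [_ [v vF <-]|_ /mapP[v vF ->]].
        by apply/mapP; exists v.
      by exists v.
    apply: EP; first by exists p.
    by rewrite -FE; apply/(span_quotient sA qk).
  move=> /spanUP[a [u [/(span_id sA) Aa Eu pE]]].
  apply/spanUP; exists a, u; split=> //; apply: span_gen; split=> //.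
  have -> : a = p - u by rewrite pE addrK.
  by apply: submodB => //; apply: span_seq_sub Eu.
have /choice[z zP] : forall n, exists z : nat -> M, forall p r, r != 0 ->
    span ((A `|` N n) `|` [set` F]) (r *: p) -> span ((A `|` N n) `|` range z) p.
  (* [P] is an index from [n] on with [F] inside [N P]; the image of [N P] is the ambient submodule
     in which the closure is formed. *)
  move=> n; have [m FN] := NF F; pose P := maxn n m.
  have [sV pV [b' [phi' db']]] := qN n.
  have [sP pP [bP [phiP dbP]]] := qN P.
  have VP : q @` N n `<=` q @` N P.
    by move=> _ [x Nx <-]; exists x => //; apply: Nmono Nx; exact: leq_maxl.
  have [_ /mapP[v vF ->]|zU [zUP pG zUF]] := countable_generators prR maxR tf
      sV sP VP pV pP db' (dual_basis_locally_projective dbP) (F := [seq q v | v <- F]).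
    by exists v => //; apply: Nmono (FN v vF); exact: leq_maxr.
  exists (lift \o zU) => p r r0; rewrite -!setUA => rp.
  apply/(span_quotient sA qk).
  have -> : q @` (N n `|` range (lift \o zU)) = (q @` N n) `|` range zU.
    rewrite image_setU; congr (_ `|` _); apply/seteqP; split.
      by move=> _ [_ [i _ <-] <-]; exists i => //=; rewrite liftP.
    by move=> _ [i _ <-]; exists (lift (zU i)); [exists i|rewrite liftP].
  apply: (pG r) => //; rewrite -linearZ.
  move/(span_quotient sA qk): rp; apply: span_sub; first exact: submod_span.
  move=> _ [v [Nv|vF] <-]; first by apply: span_gen; left; exists v.
  by apply: zUF; apply: map_f.
have /choice[s sP] : forall n, exists s : seq M, forall v j, v \in F -> N n v ->
    phi j v != 0 -> @b n j \in s.
  move=> n; elim: F {FE EP zP} => [|v F' [s sP]]; first by exists [::].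
  have [_ _ phiP] := dbN n.
  have [Nv|nNv] := pselect (N n v); last first.
    by exists s => w j; rewrite in_cons => /predU1P[->//|]; exact: sP.
  have [l [_ lP _]] := phiP v Nv.
  exists ([seq b j | j <- l] ++ s) => w j.
  rewrite in_cons mem_cat => /predU1P[-> _ /lP jl|wF Nw pw].
    by rewrite map_f.
  by rewrite (sP w)// orbT.
have [kE kEP] := range_pair (fun n => nth 0 (E n)).
have [kz kzP] := range_pair z.
have [ks ksP] := range_pair (fun n => nth 0 (s n)).
have [k1 k1P] := range_merge kE kz; have [k kP] := range_merge k1 ks.
exists k; split.
- move=> n p Np ASp; have [EN EPn] := EP n; apply: span_mono (EPn p Np ASp).
  move=> v [ANv|vE]; [by left|right]; split; last exact: EN.
  rewrite kP k1P; left; left; apply/kEP; exists n.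
  by exists (index v (E n)) => //; rewrite nth_index.
- move=> n p r r0 rp; apply: span_mono (zP n p r r0 rp).
  move=> v [ANv|zv]; [by left|right].
  by rewrite kP k1P; left; right; apply/kzP; exists n.
- move=> n v j vF Nv pv; rewrite kP; right; apply/ksP; exists n.
  by exists (index (b j) (s n)) => //; rewrite nth_index//; apply: sP Nv pv.
Qed.

(** [Z] is the closure of [x] under [K]. Each relation to be checked involves a finite part [F] of
    [Z], and the range of [K F] is again inside [Z]. *)
Lemma hill_extend A x : hill A -> exists Z : nat -> M,
  hill (span (A `|` range Z)) /\ range Z x.
Proof.
move=> hA; have [sA hA1 hA2] := hA.
have /choice[K KP] : forall F, exists k : nat -> M, _ :=
  fun F => hill_generators F hA.
have [Z [Zx ZK]] := countable_closure x K.
exists Z; split=> //; split; first exact: submod_span.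
- move=> n a j /spanUP[a' [u [Aa' /span_seq_finite[F FZ Fu] aE]]] Na pa.
  have [KP1 _ _] := KP F.
  have : span ((A `&` N n) `|` (range (K F) `&` N n)) a.
    apply: KP1 => //; apply/spanUP; exists a', u; split=> //.
  pose B := span (A `|` range Z).
  (* Elements of [N n] whose supporting basis vectors lie in [B] form a submodule, so only
     generators need checking. *)
  have sC : submod [set v | N n v /\ forall j, @phi n j v != 0 -> B (b j)].
    have [_ phil _] := dbN n.
    split; first split=> [|i]; first by case: (sN n).
      by rewrite (linear_on0 (sN n) (phil i)) eqxx.
    move=> c v w [Nv vB] [Nw wB]; split=> [|i]; first by case: (sN n) => _; apply.
    rewrite phil//; have [v0|/vB//] := eqVneq (phi i v) 0.
    by rewrite v0 mulr0 add0r => /wB.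
  move=> /(span_sub sC) h; have [|_] := h; last exact.
  move=> v [[Av Nv]|[[i _ <-] Nv]]; split=> // m.
    by move=> pv; apply: span_gen; left; apply: hA1 pv.
  move=> pv; apply: span_gen; right.
  have [_ _ /(_ n (K F i) m (mem_head _ _) Nv pv)[l _ <-]] := KP [:: K F i].
  by apply: (ZK) => w; rewrite inE => /eqP->; apply: (ZK).
- move=> n r p r0 rp.
  have /spanUP[a [u [ANa /span_seq_finite[F FZ Fu] rpE]]] :
      span ((A `|` N n) `|` range Z) (r *: p).
    apply: span_sub rp; first exact: submod_span.
    move=> v [|Nv]; last by apply: span_gen; left; right.
    by apply: span_mono => w [Aw|Zw]; [left; left|right].
  have [_ KP2 _] := KP F.
  have : span ((A `|` N n) `|` range (K F)) p.
    by apply: (KP2 n p r) => //; apply/spanUP; exists a, u.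
  apply: span_mono => v [[Av|Nv]|[i _ <-]].
  + by left; apply: span_gen; left.
  + by right.
  + by left; apply: span_gen; right; apply: ZK.
Qed.

(** In the quotient by [S], [pi] projects onto the closure of [F], and the second projection expands
    what [pi] leaves. The functionals [psi] thus vanish on the smaller closure, and subtracting the
    expansion from [v] leaves [pi (q v)] modulo [S]. *)
Lemma lift_step (A' B' : lmodType R) (g : {linear A' -> B'}) (f : {linear M -> B'})
    (S : set M) (F : seq M) (e : M) (G : set (M * A')) :
  (forall y, exists x, g x = y) -> hill S ->
  partial_lift g f G -> dom G = purif (S `|` [set` F]) ->
  exists G', [/\ partial_lift g f G', G `<=` G' &
    dom G' = purif (S `|` [set` e :: F])].
Proof.
move=> gs hS GP GC; have [sS _ _] := hS.
have [U [q [qs qk tf qN]]] := hill_quotient hS.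
have [n FN] := NF (e :: F).
have [sV pV [b' [phi' db']]] := qN n.
have lpV := dual_basis_locally_projective db'.
have imE (H : seq M) : q @` [set` H] = [set` [seq q v | v <- H]].
  apply/seteqP; split=> [_ [v vF <-]|_ /mapP[v vF ->]]; last by exists v.
  by apply/mapP; exists v.
have pqE (H : seq M) v : purif [set` [seq q v | v <- H]] (q v) <->
    purif (S `|` [set` H]) v by rewrite -imE; exact: purif_quotient.
have eFV v : v \in [seq q v | v <- e :: F] -> (q @` N n) v.
  by move=> /mapP[w wF ->]; exists w => //; apply: FN.
have FV v : v \in [seq q v | v <- F] -> (q @` N n) v.
  by move=> vF; apply: eFV; rewrite in_cons vF orbT.
have [I [h [d [hl Vd Fd hE]]]] := pure_projection prR tf sV lpV FV.
have [J [h' [d' [hl' Vd' Fd' hE']]]] := pure_projection prR tf sV lpV eFV.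
pose pi u := \sum_i h i u *: d i.
have Vpi u : (q @` N n) (pi u) by apply: submod_sum => // i _; apply: submodZ.
have Fpi u : purif [set` [seq q v | v <- F]] (pi u).
  by apply: submod_sum => [|i _]; [|apply: submodZ (Fd i)]; exact: submod_purif.
have /choice[lift liftP] : forall u, exists x, q x = u by exact: qs.
have CV v : purif (S `|` [set` e :: F]) v -> (q @` N n) (q v).
  by move=> /pqE; apply: purif_sub.
pose psi j v := h' j (q v - pi (q v)).
have Vrest u : (q @` N n) u -> (q @` N n) (u - pi u) by move=> ?; exact: submodB.
have sub : purif (S `|` [set` F]) `<=` purif (S `|` [set` e :: F]).
  apply: purif_mono => v [|vF]; [by left|right].
  by rewrite /mkset in_cons vF orbT.
have subU : purif [set` [seq q v | v <- F]] `<=`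
    purif [set` [seq q v | v <- e :: F]].
  by apply: purif_mono => v /= vF; rewrite in_cons vF orbT.
have [|||||G' G'P] := @partial_lift_extend _ _ _ _ g f gs G
    (purif (S `|` [set` e :: F])) J psi (lift \o d') GP.
- exact: submod_purif.
- by rewrite GC.
- move=> j c u v Cu Cv; rewrite /psi linearP.
  rewrite -hl'; try by apply/Vrest/CV.
  congr (h' j _); rewrite /pi (sum_linear _ _ hl); try exact: CV.
  by rewrite scalerBr opprD addrACA.
- move=> j v; rewrite GC => Cv; rewrite /psi.
  rewrite /pi -(hE (q v)); [|exact/CV/sub|exact/pqE].
  by rewrite subrr (linear_on0 sV (hl' j)).
- move=> v Cv; rewrite GC; apply/pqE.
  rewrite linearB linear_sum.
  under eq_bigr do rewrite linearZ /= liftP.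
  rewrite -(hE' (q v - pi (q v))); [by rewrite subKr|exact/Vrest/CV|].
  apply: submodB; [exact: submod_purif|exact/pqE|exact/subU/Fpi].
- by exists G'.
Qed.

Lemma lift_hill (A' B' : lmodType R) (g : {linear A' -> B'}) (f : {linear M -> B'})
    (S : set M) (Z : nat -> M) (G : set (M * A')) :
  (forall y, exists x, g x = y) -> hill S -> hill (span (S `|` range Z)) ->
  partial_lift g f G -> dom G = S ->
  exists G', [/\ partial_lift g f G', G `<=` G' & dom G' = span (S `|` range Z)].
Proof.
move=> gs hS hB GP GS; have [sS _ _] := hS; have pS := hill_pure hS.
(* The reversal puts each new element at the head, where [lift_step] adds it. *)
pose pre k := rev [seq Z i | i <- iota 0 k].
pose C k := purif (S `|` [set` pre k]).
have [||G' [G'P GG' G'C]] := @partial_lift_chain _ _ _ _ g f C G _ GP.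
- move=> k H HP HC; rewrite /C /pre -addn1 iotaD map_cat rev_cat.
  exact: lift_step.
- rewrite GS; apply/seteqP; split=> [x Sx|].
    by apply/span_purif/span_gen; left.
  by apply: purif_sub => // x [].
exists G'; split=> //; rewrite G'C; apply/seteqP; split=> [x [k _]|x].
  apply: purif_sub; [exact: submod_span|exact: hill_pure|].
  move=> y [Sy|/=]; first by apply: span_gen; left.
  by rewrite mem_rev => /mapP[i _ ->]; apply: span_gen; right; exists i.
move=> /spanUP[a [u [Sa /span_range[k Zu] ->]]]; exists k => //.
apply: span_purif; apply/spanUP; exists a, u; split=> //.
by apply: span_mono Zu => y /=; rewrite mem_rev.
Qed.

Lemma hill_union (A' : lmodType R) (F : set (set (M * A'))) :
  F !=set0 -> total_on F subset -> (forall G, F G -> hill (dom G)) ->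
  submod (dom (\bigcup_(G in F) G)) -> hill (dom (\bigcup_(G in F) G)).
Proof.
move=> [G0 FG0] Ftot Fh sD; split=> // [n a j [y [G FG Ga]] Na pa|n r p r0 rp].
  have [_ /(_ n a j) h _] := Fh G FG.
  by have [|w Gw] := h _ Na pa; [exists y|exists w, G].
have [G FG Gp] : exists2 G, F G & span (dom G `|` N n) (r *: p).
  elim: rp => {p r r0} [v [[y [G FG Gv]]|Nv]||c u v _ [G FG Gu] _ [H FH Hv]].
  - by exists G => //; apply: span_gen; left; exists y.
  - by exists G0 => //; apply: span_gen; right.
  - by exists G0 => //; exact: span0.
  - have [GH|HG] := Ftot _ _ FG FH.
      exists H => //; apply: span_lin => //; apply: span_mono Gu.
      by move=> w [[y Gw]|]; [left; exists y; exact: GH|right].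
    exists G => //; apply: span_lin => //; apply: span_mono Hv.
    by move=> w [[y Hw]|]; [left; exists y; exact: HG|right].
have [_ _ /(_ n r p r0 Gp)] := Fh G FG; apply: span_mono.
by move=> w [[y Gw]|]; [left; exists y, G|right].
Qed.

Lemma union_projective : (forall n, pure (N n)) -> projective M.
Proof.
move=> pN A' B' g f gs.
pose Q (G : set (M * A')) := partial_lift g f G /\ hill (dom G).
(* The zero lift starts the argument; for its domain, the third clause of [hill] is the purity of
   the [N n]. *)
have Q0 : Q [set (0, 0)].
  have dE : dom [set (0 : M, 0 : A')] = [set 0].
    by apply/seteqP; split=> [x [y [-> _]]|x ->]; last by exists 0.
  split; [split|rewrite dE; split].
  - by [].
  - by move=> c u y v w [-> ->] [-> ->]; rewrite /= !scaler0 !addr0.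
  - by move=> x y y' [_ ->] [_ ->].
  - by move=> x y [-> ->]; rewrite !linear0.
  - by split=> // c u v -> ->; rewrite scaler0 addr0.
  - move=> n a j -> _; have [_ phil _] := dbN n.
    by rewrite (linear_on0 (sN n) (phil j)) eqxx.
  - move=> n r p r0 rp; apply: span_gen; right; apply: (pN n r) => //.
    by apply: span_sub rp => // v [->|//]; case: (sN n).
have [|G [[GP hG] _ Gmax]] := Zorn_union Q0.
  move=> F F0 FQ Ftot; have FP : F `<=` partial_lift g f by move=> G /FQ[].
  have UP := partial_lift_union F0 FP Ftot; split=> //.
  by apply: hill_union => // [G /FQ[]//|]; exact: submod_dom UP.
have Gtot x : dom G x.
  have [Z [hZ Zx]] := hill_extend x hG.
  have [G' [G'P GG' G'Z]] := lift_hill gs hG hZ GP erefl.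
  have [y G'x] : dom G' x by rewrite G'Z; apply: span_gen; right.
  by exists y; apply: (Gmax G') => //; split=> //; rewrite G'Z.
have /choice[h hP] : forall x, exists y, G (x, y) by exact: Gtot.
have [_ GL Gf Gg] := GP.
have hl : linear h by move=> c u v; apply: Gf (hP _) _; exact: GL.
have [H HE] := linear_pack hl.
by exists H => x; rewrite HE; exact: Gg (hP x).
Qed.

End Hill.

(** * Torsion-freeness and purity from the hypotheses *)

Lemma dual_basis_torsion_free (R : idomainType) (U : lmodType R) (N : set U)
    (X : choiceType) (b : X -> U) phi (r : R) u :
  submod N -> dual_basis N b phi -> N u -> r != 0 -> r *: u = 0 -> u = 0.
Proof.
move=> sN [_ phil phiP] Nu r0 ru; have [l [_ _ ->]] := phiP u Nu.
apply: big1 => j _.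
have /eqP : r * phi j u = 0.
  by rewrite -(linear_onZ r sN (phil j))// ru (linear_on0 sN (phil j)).
by rewrite mulf_eq0 (negPf r0) => /eqP->; rewrite scale0r.
Qed.

(** Purity is applied to the single equation with coefficient [r] and right-hand side [r *: p]; by
    torsion-freeness its solution in [N] is [p]. *)
Lemma pure_submodule_pure (R : idomainType) (M : lmodType R)
    (N : submodClosed M) :
  torsion_free M -> pure_submodule N -> pure [set` N].
Proof.
move=> tf pN r p r0 rp.
have [|x [xN xE]] := pN 1%N 1%N (const_mx r) (fun=> r *: p) (fun=> rp).
  by exists (fun=> p) => i; rewrite big_ord1 mxE.
have := xE 0; rewrite big_ord1 mxE => /(torsion_freeI tf r0) <-.
exact: xN.
Qed.

Theorem corollary15 (R : idomainType) (M : lmodType R)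
    (N : nat -> submodClosed M) :
  prufer_domain R ->
  countable [set I : ideal R | maximal_ideal I]%classic ->
  N 0%N =i pred1 (0 : M) ->
  (forall n : nat, {subset N n <= N n.+1}) ->
  (forall n : nat, projective (submodule_type (N n))) ->
  (forall n : nat, pure_submodule (N n)) ->
  (forall x : M, exists n : nat, x \in N n) ->
  projective M.
Proof.
move=> prR maxR N0 NS Nproj Npure Ncov.
have sN n : submod [set` N n].
  by split=> [|c u v uN vN]; [exact: rpred0|apply: rpredD => //; exact: rpredZ].
have db n := projective_dual_basis (Nproj n).
have tf : torsion_free M.
  move=> r u r0; have [n uN] := Ncov u; have [phi phiP] := db n.
  exact: (dual_basis_torsion_free (sN n) phiP).
pose phi n := sval (cid (db n)).
(* The dual basis of [N n] is indexed by the elements of [N n] themselves. *)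
apply: (@union_projective R M (fun n => [set` N n])
  (fun n => submodule_type (N n)) (fun n => \val) phi) => // [x|n|n].
- by rewrite /mkset N0 => /eqP.
- exact: svalP (cid (db n)).
- exact: pure_submodule_pure.
Qed.
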